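(* Let $r'\geq 1$. (Beurling case) For every $k>0$ there exists an ultrapolynomial $P(z)$ of class $(M_p)$ on $\mathbb{C}^d$ such that $P$ does not vanish on $\mathbb{R}^d$ and such that there exists $C>0$ with $$\left|D^{\alpha}\left(\frac{1}{P(x)}\right)\right|\leq C\,\frac{\alpha!}{r'^{|\alpha|}}\, e^{-M(k|x|)}\quad\text{for all } x\in\mathbb{R}^d,\ \alpha\in\mathbb{N}^d .$$ (Roumieu case) For every $(k_p)\in\mathfrak{R}$ there exists an ultrapolynomial $P(z)$ of class $\{M_p\}$ on $\mathbb{C}^d$ such that $P$ does not vanish on $\mathbb{R}^d$ and such that there exists $C>0$ with $$\left|D^{\alpha}\left(\frac{1}{P(x)}\right)\right|\leq C\,\frac{\alpha!}{r'^{|\alpha|}}\, e^{-N_{k_p}(|x|)}\quad\text{for all } x\in\mathbb{R}^d,\ \alpha\in\mathbb{N}^d .$$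
   Context: $\mathbb{N}=\{0,1,2,\dots\}$, $\mathbb{Z}_+=\{1,2,\dots\}$. $\{M_p\}_{p\in\mathbb{N}}$ is a sequence of positive numbers with $M_0=M_1=1$ satisfying: (M.1) $M_p^2\leq M_{p-1}M_{p+1}$ for $p\in\mathbb{Z}_+$; (M.2) there are $c_0,H\geq 1$ such that $M_p\leq c_0H^p\min_{0\leq q\leq p}\{M_{p-q}M_q\}$ for $p\in\mathbb{N}$; (M.5) there exists $q>0$ such that $M_p^q$ is strongly non-quasianalytic, i.e. there is $c_0\geq1$ with $\sum_{j=p+1}^{\infty}M_{j-1}^q/M_j^q\leq c_0\,p\,M_p^q/M_{p+1}^q$ for all $p\in\mathbb{Z}_+$. For a multi-index $\alpha$, $M_\alpha=M_{|\alpha|}$ and $D^\alpha=(-i)^{|\alpha|}\partial^\alpha$. The associated function of $M_p$ is $M(\rho)=\sup_{p\in\mathbb{N}}\log_+(\rho^p/M_p)$. $\mathfrak{R}$ is the set of all positive sequences $(k_p)_{p\in\mathbb{Z}_+}$ which increase to $\infty$. For $(k_p)\in\mathfrak{R}$, $N_{k_p}(\rho)=\sup_{p\in\mathbb{N}}\log_+\big(\rho^p/(M_p\prod_{j=1}^pk_j)\big)$ is the associated function of the sequence $M_p\prod_{j=1}^pk_j$. An ultrapolynomial of class $(M_p)$ (resp. of class $\{M_p\}$) is a power series $P(z)=\sum_{\alpha\in\mathbb{N}^d}c_\alpha z^\alpha$, $z\in\mathbb{C}^d$, whose coefficients satisfy: there exist $L,C>0$ (resp. for every $L>0$ there exists $C>0$)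 such that $|c_\alpha|\leq CL^{|\alpha|}/M_\alpha$ for all $\alpha\in\mathbb{N}^d$. *)

(* Defs.v *)
From mathcomp Require Import all_boot all_order all_algebra.
From mathcomp Require Import all_classical all_reals all_analysis.
From mathcomp Require Import complex.
From mathcomp.analysis.showcase Require summability.

Set Implicit Arguments.
Unset Strict Implicit.
Unset Printing Implicit Defensive.

Import Order.TTheory GRing.Theory Num.Theory.
Import numFieldNormedType.Exports.

Local Open Scope classical_set_scope.
Local Open Scope ring_scope.
Local Open Scope complex_scope.

Section weight_sequences.
Variable R : realType.
Implicit Types (M A k : nat -> R) (rho : R).

Definition log_convex M : Prop :=
  forall p, (0 < p)%N -> M p ^+ 2 <= M p.-1 * M p.+1.

(* The default value of the big minimum is its term of index q = 0. *)
Definition stable_ultradiff M : Prop :=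
  exists c0 H : R, [/\ 1 <= c0, 1 <= H & forall p,
    M p <= c0 * H ^+ p *
      \big[Num.min/M p * M 0%N]_(q < p.+1) (M (p - q)%N * M q)].

(* The series has nonnegative terms and is summed in the extended reals, so
   the inequality includes its convergence. *)
Definition strongly_nonquasianalytic A : Prop :=
  exists2 c0 : R, 1 <= c0 & forall p, (0 < p)%N ->
    (\sum_(p.+1 <= j <oo) (A j.-1 / A j)%:E
       <= (c0 * p%:R * (A p / A p.+1))%:E)%E.

Definition power_strongly_nonquasianalytic M : Prop :=
  exists2 q : R, 0 < q & strongly_nonquasianalytic (fun p => M p `^ q).

(* [ln 0 = 0], hence [log_plus 0 = 0] as it should be. *)
Definition log_plus (t : R) : R := Num.max 0 (ln t).

Definition associated_function M rho : R :=
  sup (range (fun p => log_plus (rho ^+ p / M p))).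

(* Sequences indexed by the positive integers: [k 0] is irrelevant. *)
Definition increasing_to_infinity k : Prop :=
  [/\ forall p, (0 < p)%N -> 0 < k p,
      forall p, (0 < p)%N -> k p <= k p.+1
    & k @ \oo --> +oo].

Definition mul_prod M k (p : nat) : R := M p * \prod_(1 <= j < p.+1) k j.

End weight_sequences.

Section multi_indices.
Variables (R : realType) (d : nat).
Implicit Types (alpha : {ffun 'I_d -> nat}) (x : 'rV[R]_d) (z : 'rV[R[i]]_d).

Definition mdeg alpha : nat := \sum_i alpha i.

Definition mfact alpha : nat := \prod_i (alpha i)`!.

Definition monomial alpha z : R[i] := \prod_i z 0 i ^+ alpha i.

(* The library norm on ['rV[R]_d] is the maximum norm. *)
Definition euclidean_norm x : R := Num.sqrt (\sum_i x 0 i ^+ 2).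

Definition complexify x : 'rV[R[i]]_d := map_mx (real_complex R) x.

(* [R[i]] is not a normed module over [R] in the library, so a complex-valued
   function is differentiated through its real and imaginary parts. *)
Definition partial (i : 'I_d) (f : 'rV[R]_d -> R[i]) : 'rV[R]_d -> R[i] :=
  fun x => 'D_(delta_mx 0 i) (fun y => complex.Re (f y)) x
           +i* 'D_(delta_mx 0 i) (fun y => complex.Im (f y)) x.

Definition mpartial alpha (f : 'rV[R]_d -> R[i]) : 'rV[R]_d -> R[i] :=
  foldr (fun i g => iter (alpha i) (partial i) g) f (enum 'I_d).

Definition D alpha (f : 'rV[R]_d -> R[i]) : 'rV[R]_d -> R[i] :=
  fun x => (0 -i* 1 : R[i]) ^+ mdeg alpha * mpartial alpha f x.

(* [P] is everywhere the sum of the power series with coefficients [c]; the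
   limit is taken along the finite sets of multi-indices ordered by inclusion,
   that is, the series converges unconditionally. The library puts the
   topology of the modulus on [R[i]^o]. *)
Definition power_series_sum (c : {ffun 'I_d -> nat} -> R[i])
    (P : 'rV[R[i]]_d -> R[i]) : Prop :=
  forall z, summability.partial_sum (fun alpha => c alpha * monomial alpha z)
    @ summability.totally --> (P z : R[i]^o).

Definition ultrapolynomial_Beurling (M : nat -> R)
    (P : 'rV[R[i]]_d -> R[i]) : Prop :=
  exists2 c : {ffun 'I_d -> nat} -> R[i], power_series_sum c P &
    exists L C : R, [/\ 0 < L, 0 < C & forall alpha,
      `|c alpha| <= (C * L ^+ mdeg alpha / M (mdeg alpha))%:C].

Definition ultrapolynomial_Roumieu (M : nat -> R)
    (P : 'rV[R[i]]_d -> R[i]) : Prop :=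
  exists2 c : {ffun 'I_d -> nat} -> R[i], power_series_sum c P &
    forall L : R, 0 < L -> exists2 C : R, 0 < C & forall alpha,
      `|c alpha| <= (C * L ^+ mdeg alpha / M (mdeg alpha))%:C.

End multi_indices.

(* Main.v *)
Require Import Defs.
From mathcomp Require Import all_boot all_order all_algebra.
From mathcomp Require Import all_classical all_reals all_analysis.
From mathcomp Require Import finmap complex ring lra.
From mathcomp.analysis.showcase Require Import summability.

Set Implicit Arguments.
Unset Strict Implicit.
Unset Printing Implicit Defensive.

Import Order.TTheory GRing.Theory Num.Theory.
Import numFieldNormedType.Exports.
Import numFieldTopology.Exports.

Local Open Scope classical_set_scope.
Local Open Scope ring_scope.
Local Open Scope complex_scope.

(** ** Why the theorem is true

   One looks for a product P(z) = Q(z_1) ... Q(z_d) of copies of one entire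
   function of one variable, real and positive on the real axis, namely
     Q(w) = prod_j (1 + b_j w^(2N)),
   where b_j is the minimum of a small constant and of
   (kappa B_j / B_(j+1))^(2N).  Here B = M in the Beurling case,
   B_p = M_p k_1 ... k_p in the Roumieu case, and 2N is at least the exponent
   of (M.5), which makes the tails of sum_j b_j comparable with their first
   term: sum_(j >= p) b_j <= c p b_p.  Everything rests on three estimates.

   Growth.  The product of the first p factors is at least
   prod_(j < p) b_j x^(2N), hence up to a constant at least
   ((kappa |x|)^p / B_p)^(2N), whatever p is
   ([partial_product_ge], [truncated_prod_ge]).

   Coefficients.  A coefficient e_p of a polynomial f(t) with nonnegative
   coefficients is at most f(t) / t^p.  For f(t) = prod_j (1 + b_j t) and
   t = 1 / b_p each factor with j < p is at most 2 b_j / b_p, and by the tail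
   condition the other ones contribute at most exp(c p).  Hence
   e_p <= L^p b_0 ... b_(p-1), which is of the order of L^p / B_p^(2N)
   ([product_poly_coef_le]), and (M.2) turns M_p^(2N) into M_(2Np)
   ([sparse_class]).  In the Roumieu case the factor (k_1 ... k_p)^(-2N) beats
   every geometric sequence ([prod_growth]).

   Derivatives.  A germ sum_m c_m s^m at a real point x is measured by
   sum_m |c_m| r^m.  Times m! / r^m this norm bounds the m-th derivative, as
   the maximum modulus does in the Cauchy inequalities, and it is submultiplicative and is stable
   under pointwise limits ([wienerM], [wiener_lim]), so that 1 / Q is estimated
   factor by factor, on the real line only.  The norm of
   1 / (1 + b y^n) at x is at most 1 / (1 + 2 b x^n - b (|x| + r)^n)
   ([wiener_inv_factor]).  For large |x| this is at most (1 + b x^n)^(-1/2),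
   since (|x| + r)^n is then at most 3/2 x^n; losing a square root is harmless
   because Q grows like the 2N-th power of the weight, and 2N >= 2.  For bounded |x| the product
   of these norms is bounded because the b_j are small and summable
   ([prod_factor_bound_le]).

   The partial derivatives of 1 / P factor into derivatives of 1 / Q
   ([mpartial_prod]).  All factors are bounded, and the one that belongs to the
   largest coordinate of x gives the whole weight, because |x| is at most d
   times that coordinate ([prod_derivatives_le]). *)

(** * Compactness for power series, and the Wiener algebra of a disc *)

Lemma eq_ler (R : numDomainType) (x y : R) : x = y -> x <= y.
Proof. by move->. Qed.

Lemma fmap_ultra_filter (T U : Type) (f : T -> U) (F : set_system T) :
  UltraFilter F -> UltraFilter (f @ F).
Proof.
move=> FU; split=> [|G GF FG]; rewrite ?predeqE; first exact: fmap_proper_filter.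
move=> A; split=> [GA|]; last exact: FG.
have [//|FnA] := in_ultra_setVsetC (f @^-1` A) FU.
have /FG GnA : (f @ F) (~` A) by [].
by have [] := @filter_ex _ _ GF _ (filterI GA GnA) => a [].
Qed.

Lemma cvg_sum_seq (T : Type) (F : set_system T) (R : realType) (I : Type)
    (s : seq I) (f : I -> T -> R) (l : I -> R) : Filter F ->
  (forall i, f i @ F --> l i) ->
  (fun x => \sum_(i <- s) f i x) @ F --> \sum_(i <- s) l i.
Proof.
move=> FF fl; elim: s => [|i s IH].
  by rewrite big_nil; under eq_fun do rewrite big_nil; exact: cvg_cst.
by rewrite big_cons; under eq_fun do rewrite big_cons; apply: cvgD.
Qed.

(** Normal families for power series.  Coefficient sequences dominated by [G]
    live in a product of compact intervals, so an ultrafilter finer than the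
    filter of cofinite sets gives a limit in each coordinate.  Wherever
    [sum_m G m |s|^m] converges the tails of all the series are uniformly small,
    so that a limit of their sums is the sum of the limit series. *)
Lemma pseries_coef_compact (R : realType) (c : nat -> nat -> R) (G : nat -> R) :
  (forall J m, `|c J m| <= G m) ->
  exists e : nat -> R, [/\ forall m, `|e m| <= G m,
    forall (r U : R) n, (forall J, \sum_(0 <= i < n) `|c J i| * r ^+ i <= U) ->
      \sum_(0 <= i < n) `|e i| * r ^+ i <= U
    & forall (s : R) (v : nat -> R) (l : R),
      cvgn (series (fun m => G m * `|s| ^+ m)) ->
      (forall J, pseries (c J) s @ \oo --> v J) -> v @ \oo --> l ->
      pseries e s @ \oo --> l].
Proof.
move=> cG.
have [F [FU ooF]] := ultraFilterLemma eventually_filter.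
have cvgF m : exists l : R, c ^~ m @ F --> l.
  have := @segment_compact R (- G m) (G m).
  rewrite compact_ultra => /(_ (c ^~ m @ F) (@fmap_ultra_filter _ _ (c ^~ m) F FU))[|l0 [_ Fl]].
    by apply: nearW => J /=; rewrite in_itv/= -ler_norml.
  by exists l0.
have [e eF] := choice cvgF.
exists e; split=> [m|r U n H|s v l Gs cv vl].
- have A : (fun J => `|c J m|) @ F --> `|e m| by apply: cvg_norm; exact: eF.
  by apply: (cvgr_to_le A); apply: nearW => J.
- have A : (fun J => \sum_(0 <= i < n) `|c J i| * r ^+ i) @ F -->
      \sum_(0 <= i < n) `|e i| * r ^+ i.
    by apply: cvg_sum_seq => i; apply: cvgMr_tmp; apply: cvg_norm; exact: eF.
  by apply: (cvgr_to_le A); apply: nearW => J.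
- set g := series (fun m => G m * `|s| ^+ m) in Gs.
  have dist J n k : (n <= k)%N -> `|pseries (c J) s k - pseries (c J) s n| <= g k - g n.
    move=> nk; rewrite /pseries /g !sub_series_geq//.
    apply: le_trans (ler_norm_sum _ _ _) _; apply: ler_sum => i _.
    by rewrite normrM normrX ler_wpM2r// exprn_ge0.
  have distl J n : `|v J - pseries (c J) s n| <= limn g - g n.
    have A : (fun k => `|pseries (c J) s k - pseries (c J) s n|) @ \oo -->
        `|v J - pseries (c J) s n|.
      by apply: cvg_norm; apply: cvgB (cv J) _; exact: cvg_cst.
    have B : (fun k => g k - g n) @ \oo --> limn g - g n.
      by apply: cvgB Gs _; exact: cvg_cst.
    apply: (ler_cvg_to A B).
    by exists n => // k /= nk; exact: dist.
  have diste n : `|l - pseries e s n| <= limn g - g n.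
    have A : (fun J => `|v J - pseries (c J) s n|) @ F --> `|l - pseries e s n|.
      apply: cvg_norm; apply: cvgB; first by apply: cvg_trans vl => A /= /ooF.
      by apply: cvg_sum_seq => i; apply: cvgMr_tmp; exact: eF.
    by apply: (cvgr_to_le A); apply: nearW => J.
  apply/cvgrPdist_le => eps eps0.
  have /cvgrPdist_le/(_ _ eps0) := Gs; apply: filterS => n /= ng.
  by rewrite (le_trans (diste n))// (le_trans (ler_norm _) ng).
Qed.

(** The germ of [f] at [x] belongs to the Wiener algebra of the disc of radius
    [r], with norm at most [U].  Partial sums stand for the series of absolute
    values, which spares a convergence statement. *)
Definition wiener (R : realType) (r : R) (f : R -> R) (x U : R) : Prop :=
  exists2 c : nat -> R, forall n, \sum_(0 <= i < n) `|c i| * r ^+ i <= U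
    & forall s, `|s| < r -> pseries c s @ \oo --> f (x + s).

Section wiener_germs.
Variables (R : realType) (r : R).
Hypothesis r_gt0 : 0 < r.
Implicit Types (f g : R -> R) (x U V : R).

Lemma wiener_ext f g x U : (forall s, `|s| < r -> f (x + s) = g (x + s)) ->
  wiener r f x U -> wiener r g x U.
Proof. by move=> fg [c cU cf]; exists c => // s sr; rewrite -fg//; exact: cf. Qed.

Lemma wiener_le f x U V : U <= V -> wiener r f x U -> wiener r f x V.
Proof. by move=> UV [c cU cf]; exists c => // n; exact: le_trans (cU n) UV. Qed.

Lemma wiener_ge0 f x U : wiener r f x U -> 0 <= U.
Proof. by case=> c /(_ 0%N); rewrite big_geq. Qed.

Lemma wiener_coef (c : nat -> R) U :
  (forall n, \sum_(0 <= i < n) `|c i| * r ^+ i <= U) ->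
  forall m, `|c m| <= U / r ^+ m.
Proof.
move=> cU m; rewrite ler_pdivlMr ?exprn_gt0//; apply: le_trans (cU m.+1).
rewrite big_nat_recr//= lerDr sumr_ge0// => i _.
by rewrite mulr_ge0// exprn_ge0// ltW.
Qed.

Lemma cvg_coef_bound_series U (s : R) : `|s| < r ->
  cvgn (series (fun m => U / r ^+ m * `|s| ^+ m)).
Proof.
move=> sr.
have -> : (fun m => U / r ^+ m * `|s| ^+ m) = geometric U (`|s| / r).
  by apply/funext => m; rewrite /geometric/= expr_div_n mulrAC mulrA.
apply: is_cvg_geometric_series.
by rewrite normrM normr_id normfV (gtr0_norm r_gt0) ltr_pdivrMr// mul1r.
Qed.

Lemma wiener_bound f x U (s : R) : wiener r f x U -> `|s| < r -> `|f (x + s)| <= U.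
Proof.
move=> [c cU cf] sr.
have A : (fun n => `|pseries c s n|) @ \oo --> `|f (x + s)|.
  by apply: cvg_norm; exact: cf.
apply: (cvgr_to_le A); apply: nearW => n; apply: le_trans (cU n).
rewrite /pseries /series/=; apply: le_trans (ler_norm_sum _ _ _) _.
apply: ler_sum => i _; rewrite normrM normrX ler_wpM2l//.
by rewrite lerXn2r ?nnegrE ?(ltW r_gt0)// ltW.
Qed.


(** Balls of the Wiener algebra are closed under pointwise limits: the limit
    germ has coefficients because those of the approximants stay in a compact
    set.  All infinite constructions on germs below go through this lemma. *)
Lemma wiener_lim (f_ : nat -> R -> R) f x U :
  (forall J, wiener r (f_ J) x U) ->
  (forall s, `|s| < r -> f_ ^~ (x + s) @ \oo --> f (x + s)) ->
  wiener r f x U.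
Proof.
move=> /(_ _)/cid2 W ff; pose c J := s2val (W J).
have cU J n : \sum_(0 <= i < n) `|c J i| * r ^+ i <= U by rewrite /c; case: (W J).
have cf J s : `|s| < r -> pseries (c J) s @ \oo --> f_ J (x + s).
  by rewrite /c; case: (W J) => a /= _; apply.
have [e [_ eU el]] := @pseries_coef_compact R c (fun m => U / r ^+ m)
  (fun J => wiener_coef (cU J)).
exists e => [n|s sr]; first exact: eU.
apply: (el s (fun J => f_ J (x + s))) (ff s sr) => [|J]; [exact: cvg_coef_bound_series|exact: cf].
Qed.

Lemma wiener_cst (a : R) x : wiener r (fun=> a) x `|a|.
Proof.
exists (fun i => if i is 0%N then a else 0) => [[|n]|s sr].
- by rewrite big_geq.
- rewrite big_nat_recl//= expr0 mulr1 big1 ?addr0// => i _.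
  by rewrite normr0 mul0r.
- rewrite -cvg_shiftS; apply: cvg_near_cst; apply: nearW => n.
  rewrite /pseries /series/= big_nat_recl//= expr0 mulr1 big1 ?addr0// => i _.
  by rewrite mul0r.
Qed.

Lemma wienerD f g x U V : wiener r f x U -> wiener r g x V ->
  wiener r (fun y => f y + g y) x (U + V).
Proof.
move=> [c cU cf] [e eV eg]; exists (fun i => c i + e i) => [n|s sr].
- apply: le_trans (lerD (cU n) (eV n)); rewrite -big_split/=; apply: ler_sum => i _.
  by rewrite -mulrDl ler_wpM2r ?ler_normD// exprn_ge0// ltW.
- have -> : pseries (fun i => c i + e i) s = pseries c s + pseries e s.
    apply/funext => n; rewrite /pseries /series/= fctE -big_split/=.
    by apply: eq_bigr => i _; rewrite mulrDl.
  by apply: cvgD; [exact: cf|exact: eg].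
Qed.

Lemma wienerZ (a : R) f x U : wiener r f x U -> wiener r (fun y => a * f y) x (`|a| * U).
Proof.
move=> [c cU cf]; exists (fun i => a * c i) => [n|s sr].
- under eq_bigr do rewrite normrM -mulrA.
  by rewrite -mulr_sumr ler_wpM2l.
- have -> : pseries (fun i => a * c i) s = (fun n => a * pseries c s n).
    apply/funext => n; rewrite /pseries /series/= mulr_sumr.
    by apply: eq_bigr => i _; rewrite mulrA.
  by apply: cvgMl_tmp; exact: cf.
Qed.

(** Multiplication by the local coordinate shifts the coefficients; together
    with scaling, sums and limits it yields all products. *)
Lemma wiener_shift f x U : wiener r f x U ->
  wiener r (fun y => (y - x) * f y) x (r * U).
Proof.
move=> [c cU cf]; exists (fun i => if i is j.+1 then c j else 0) => [[|n]|s sr].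
- by rewrite big_geq// mulr_ge0// ?(ltW r_gt0)//; have := cU 0%N; rewrite big_geq.
- rewrite big_nat_recl//= normr0 mul0r add0r.
  under eq_bigr do rewrite exprS mulrCA.
  by rewrite -mulr_sumr ler_wpM2l// ltW.
- rewrite -cvg_shiftS.
  have -> : (fun n => pseries (fun i => if i is j.+1 then c j else 0) s n.+1) =
      (fun n => s * pseries c s n).
    apply/funext => n; rewrite /pseries /series/= big_nat_recl//= mul0r add0r mulr_sumr.
    by apply: eq_bigr => i _; rewrite exprS mulrCA.
  have -> : x + s - x = s by ring.
  by apply: cvgMl_tmp; exact: cf.
Qed.

Lemma wiener_sum (f_ : nat -> R -> R) (U_ : nat -> R) x n :
  (forall i, wiener r (f_ i) x (U_ i)) ->
  wiener r (fun y => \sum_(0 <= i < n) f_ i y) x (\sum_(0 <= i < n) U_ i).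
Proof.
move=> W; elim: n => [|n IH].
  rewrite big_geq//; apply: wiener_ext (wiener_le _ (wiener_cst 0 x)); last by rewrite normr0.
  by move=> s _; rewrite big_geq.
rewrite big_nat_recr//=; apply: wiener_ext (wienerD IH (W n)).
by move=> s _; rewrite big_nat_recr.
Qed.

(** Submultiplicativity without Cauchy products: [f * g] is the pointwise limit
    of the [p * g] with [p] a Taylor polynomial of [f], and such a product is
    a combination of iterated shifts of the germ of [g]. *)
Lemma wienerM f g x U V : wiener r f x U -> wiener r g x V ->
  wiener r (fun y => f y * g y) x (U * V).
Proof.
move=> [c cU cf] Wg.
pose F n y := \sum_(0 <= i < n) c i * ((y - x) ^+ i * g y).
have WF n : wiener r (F n) x (U * V).
  have W i : wiener r (fun y => c i * ((y - x) ^+ i * g y)) x (`|c i| * (r ^+ i * V)).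
    apply: wienerZ; elim: i => [|i IH].
      by rewrite expr0 mul1r; apply: wiener_ext Wg => s _; rewrite expr0 mul1r.
    rewrite exprS -mulrA; apply: wiener_ext (wiener_shift IH) => s _.
    by rewrite exprS mulrA.
  apply: wiener_le (wiener_sum n W).
  under eq_bigr do rewrite mulrA.
  by rewrite -mulr_suml ler_wpM2r// (wiener_ge0 Wg).
apply: wiener_lim WF _ => s sr.
have -> : F ^~ (x + s) = (fun n => pseries c s n * g (x + s)).
  apply/funext => n; rewrite /F /pseries /series/= mulr_suml; apply: eq_bigr => i _.
  by rewrite mulrA; congr (_ * _ ^+ _ * _); ring.
by apply: cvgMr_tmp; exact: cf.
Qed.

Lemma wiener_prod (f_ : nat -> R -> R) (U_ : nat -> R) x n :
  (forall i, wiener r (f_ i) x (U_ i)) ->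
  wiener r (fun y => \prod_(0 <= i < n) f_ i y) x (\prod_(0 <= i < n) U_ i).
Proof.
move=> W; elim: n => [|n IH].
  rewrite big_geq//; apply: wiener_ext (wiener_le _ (wiener_cst 1 x)); last by rewrite normr1.
  by move=> s _; rewrite big_geq.
rewrite big_nat_recr//=; apply: wiener_ext (wienerM IH (W n)).
by move=> s _; rewrite big_nat_recr.
Qed.

(** The Neumann series, again a pointwise limit of germs. *)
Lemma wiener_inv1B f x U : wiener r f x U -> U < 1 ->
  wiener r (fun y => (1 - f y)^-1) x (1 - U)^-1.
Proof.
move=> W U1; have U0 := wiener_ge0 W.
pose F n y := \sum_(0 <= k < n) f y ^+ k.
have geo (z : R) : `|z| < 1 -> (fun n => \sum_(0 <= k < n) z ^+ k) @ \oo --> (1 - z)^-1.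
  move=> z1; rewrite -div1r.
  have -> : (fun n => \sum_(0 <= k < n) z ^+ k) = series (geometric 1 z).
    by apply/funext => n; apply: eq_bigr => i _; rewrite /geometric/= mul1r.
  exact: cvg_geometric_series.
apply: (@wiener_lim F) => [n|s sr]; last first.
  by apply: geo; exact: le_lt_trans (wiener_bound W sr) U1.
have W1 k : wiener r (fun y => f y ^+ k) x (U ^+ k).
  elim: k => [|k IH].
    rewrite expr0 -(normr1 R); apply: wiener_ext (wiener_cst 1 x) => s _.
    by rewrite expr0.
  by rewrite exprS; apply: wiener_ext (wienerM W IH) => s _; rewrite exprS.
apply: wiener_le (wiener_sum n W1).
have A := geo U; rewrite ger0_norm// in A.
rewrite -(cvg_lim _ (A U1))//; apply: nondecreasing_cvgn_le; last first.
  by apply/cvg_ex; exists (1 - U)^-1; exact: A.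
by apply/nondecreasing_seqP => k; rewrite big_nat_recr//= lerDl exprn_ge0//.
Qed.

End wiener_germs.

(** * Derivatives of germs in the Wiener algebra *)

(** [n * t ^ n] is at most the [n]-th partial sum of the geometric series. *)
Lemma natmul_expr_le (R : realFieldType) (t : R) n : 0 <= t -> t < 1 ->
  n%:R * t ^+ n <= (1 - t)^-1.
Proof.
move=> t0 t1; have t1' : 0 < 1 - t by rewrite subr_gt0.
rewrite -[_^-1]mul1r ler_pdivlMr//.
have : (1 - t) * (\sum_(i < n) t ^+ i) <= 1.
  by rewrite -opprB mulNr -subrX1 opprB lerBlDr lerDl exprn_ge0.
apply: le_trans; rewrite mulrC ler_pM2l//.
have -> : n%:R * t ^+ n = \sum_(i < n) t ^+ n by rewrite sumr_const card_ord mulr_natl.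
apply: ler_sum => i _; apply: ler_wiXn2l => //; [exact: ltW|exact: ltnW].
Qed.

Section power_series_tower.
Variables (R : realType) (r : R).
Implicit Types (c : nat -> R) (f : R -> R).

(** Boundedness of the terms at each smaller radius: this form of a lower bound
    on the radius of convergence passes at once to the derived series. *)
Definition radius_ge c := forall rho : R, 0 < rho -> rho < r ->
  exists B, forall i, `|c i| * rho ^+ i <= B.

Lemma between_norm (s : R) : `|s| < r -> exists2 rho, `|s| < rho & rho < r.
Proof. by move=> sr; exists ((`|s| + r) / 2); [rewrite midf_lt|rewrite midf_lt]. Qed.

Lemma radius_ge_cvg c (s : R) : radius_ge c -> `|s| < r -> cvgn (pseries c s).
Proof.
move=> rc sr; have [rho srho rhor] := between_norm sr.
have rho0 : 0 < rho by exact: le_lt_trans srho.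
have [B cB] := rc _ rho0 rhor.
apply: normed_cvg; apply: (@series_le_cvg _ _ (geometric B (`|s| / rho))).
- by move=> n; exact: normr_ge0.
- move=> n; rewrite mulr_ge0 ?exprn_ge0 ?divr_ge0 ?(ltW rho0)//.
  by apply: le_trans (cB 0%N); rewrite mulr_ge0 ?exprn_ge0 ?(ltW rho0).
- move=> n; rewrite /geometric/= normrM normrX expr_div_n.
  by rewrite mulrCA mulrC ler_wpM2l ?exprn_ge0// ler_pdivlMr ?exprn_gt0.
apply: is_cvg_geometric_series.
by rewrite normrM normr_id normfV (gtr0_norm rho0) ltr_pdivrMr// mul1r.
Qed.

Lemma radius_ge_diffs c : radius_ge c -> radius_ge (pseries_diffs c).
Proof.
move=> rc rho rho0 rhor.
have [s rhos sr] : exists2 s, rho < s & s < r.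
  by have [|s] := @between_norm rho; rewrite (gtr0_norm rho0)//; exists s.
have s0 := lt_trans rho0 rhos.
have [B cB] := rc _ s0 sr.
exists (B / rho * (1 - rho / s)^-1) => i.
rewrite /pseries_diffs normrM normr_nat.
have t0 : 0 <= rho / s by rewrite divr_ge0 ?ltW.
have t1 : rho / s < 1 by rewrite ltr_pdivrMr// mul1r.
have -> : i.+1%:R * `|c i.+1| * rho ^+ i =
  (`|c i.+1| * s ^+ i.+1 / rho) * (i.+1%:R * (rho / s) ^+ i.+1).
  rewrite expr_div_n (exprS rho) ; field.
  by rewrite !gt_eqF ?exprn_gt0.
apply: ler_pM; rewrite ?divr_ge0 ?mulr_ge0 ?exprn_ge0 ?(ltW s0) ?(ltW rho0)//.
  by rewrite ler_wpM2r// invr_ge0 ltW.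
exact: natmul_expr_le.
Qed.

(** Termwise differentiation at an arbitrary point of the disc, for a function
    that is only known to be the sum of the series on that disc. *)
Lemma power_series_derive c f x : radius_ge c ->
  (forall s, `|s| < r -> pseries c s @ \oo --> f (x + s)) ->
  forall s : R, `|s| < r ->
    is_derive (x + s) (1 : R) f (limn (pseries (pseries_diffs c) s)).
Proof.
move=> rc cf s sr; have [rho srho rhor] := between_norm sr.
have rho0 : 0 < rho by exact: le_lt_trans srho.
have rhor' : `|rho| < r by rewrite gtr0_norm.
have rc1 := radius_ge_diffs rc; have rc2 := radius_ge_diffs rc1.
have srho' : `|s| < `|rho| by rewrite (gtr0_norm rho0).
have D := pseries_snd_diffs (radius_ge_cvg rc rhor') (radius_ge_cvg rc1 rhor')
  (radius_ge_cvg rc2 rhor') srho'.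
have D1 : is_derive (x + s) (1 : R) ((fun y => limn (pseries c y)) \o (fun y => y - x))
   (limn (pseries (pseries_diffs c) s) * 1).
  apply: is_derive1_comp.
    by rewrite (_ : x + s - x = s)//; ring.
  by apply: is_derive_eq; rewrite subr0.
rewrite mulr1 in D1; apply: near_eq_is_derive D1.
have : \forall y \near x + s, `|y - x| < r.
  have A : (fun y : R => `|y - x|) @ (x + s) --> `|x + s - x|.
    by apply: cvg_norm; apply: cvgB; [exact: cvg_id|exact: cvg_cst].
  by apply: (cvgr_lt _ A); rewrite (_ : x + s - x = s)//; ring.
apply: filterS => y yr /=.
by rewrite (cvg_lim _ (cf _ yr))//; congr f; ring.
Qed.

Lemma radius_ge_iter c m : radius_ge c -> radius_ge (iter m (@pseries_diffs R) c).
Proof. by move=> rc; elim: m => //= m IH; exact: radius_ge_diffs. Qed.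

Lemma power_series_derive1n c f x m : radius_ge c ->
  (forall s, `|s| < r -> pseries c s @ \oo --> f (x + s)) ->
  forall s : R, `|s| < r ->
    pseries (iter m (@pseries_diffs R) c) s @ \oo --> derive1n m f (x + s).
Proof.
move=> rc cf; elim: m => [|m IH] s sr; first by rewrite derive1n0; exact: cf.
have rcm := radius_ge_iter m rc.
have [_ E] := power_series_derive rcm IH sr.
by rewrite derive1nS derive1E E; apply: radius_ge_cvg => //=; exact: radius_ge_diffs.
Qed.

Lemma iter_pseries_diffs0 c m : iter m (@pseries_diffs R) c 0%N = m`!%:R * c m.
Proof.
suff H k : iter m (@pseries_diffs R) c k * k`!%:R = (m + k)`!%:R * c (m + k)%N.
  by have := H 0%N; rewrite fact0 mulr1 addn0.
elim: m k => [|m IH] k; first by rewrite mulrC.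
by rewrite iterS {1}/pseries_diffs mulrAC -natrM -factS mulrC IH addSnnS.
Qed.

End power_series_tower.

Section wiener_derive.
Variables (R : realType) (r : R).
Hypothesis r_gt0 : 0 < r.

Lemma wiener_radius (c : nat -> R) (U : R) :
  (forall n, \sum_(0 <= i < n) `|c i| * r ^+ i <= U) -> radius_ge r c.
Proof.
move=> cU rho rho0 rhor; exists U => i.
have := wiener_coef r_gt0 cU i; rewrite ler_pdivlMr ?exprn_gt0//; apply: le_trans.
by rewrite ler_wpM2l// lerXn2r ?nnegrE ?ltW.
Qed.

Lemma wiener_is_derive (f : R -> R) (x U : R) m : wiener r f x U ->
  is_derive x (1 : R) (derive1n m f) (derive1n m.+1 f x).
Proof.
move=> [c /wiener_radius rc cf].
have r0 : `|0 : R| < r by rewrite normr0.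
have [D _] := power_series_derive (radius_ge_iter m rc) (power_series_derive1n rc cf (m := m)) r0.
by rewrite addr0 in D; rewrite derive1nS derive1E; exact: derivableP.
Qed.

(** The counterpart of the Cauchy inequalities: the [m]-th derivative at the
    centre is [m!] times the [m]-th coefficient. *)
Lemma wiener_derive1n_le (f : R -> R) (x U : R) m : wiener r f x U ->
  `|derive1n m f x| <= m`!%:R / r ^+ m * U.
Proof.
move=> [c cU cf].
have r0 : `|0 : R| < r by rewrite normr0.
have := power_series_derive1n (wiener_radius cU) cf (m := m) r0; rewrite addr0.
have A : pseries (iter m (@pseries_diffs R) c) 0 @ \oo --> m`!%:R * c m.
  rewrite -iter_pseries_diffs0 -cvg_shiftS; apply: cvg_near_cst; apply: nearW => n.
  rewrite /pseries /series/= big_nat_recl//= expr0 mulr1 big1 ?addr0// => i _.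
  by rewrite exprS mul0r mulr0.
move=> /(cvg_unique _ A)-/(_ (@norm_hausdorff _ _)) <-.
rewrite normrM normr_nat -mulrA ler_wpM2l// mulrC.
exact: wiener_coef.
Qed.

End wiener_derive.

(** * Canonical products over sequences with controlled tails *)

Section canonical_product.
Variables (R : realType) (b : nat -> R) (c : R).
Hypothesis b_gt0 : forall j, 0 < b j.
Hypothesis b_noninc : forall i j, (i <= j)%N -> b j <= b i.
Hypothesis b_tail : forall p n, (0 < p)%N ->
  \sum_(p <= j < n) b j <= c * p%:R * b p.

Definition partial_product J (t : R) : R := \prod_(0 <= j < J) (1 + b j * t).

Lemma factor_ge1 j t : 0 <= t -> 1 <= 1 + b j * t.
Proof. by move=> t0; rewrite lerDl mulr_ge0// ltW. Qed.

Lemma prod_ge1 (I : Type) (s : seq I) (F : I -> R) :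
  (forall i, 1 <= F i) -> 1 <= \prod_(i <- s) F i.
Proof.
move=> F1; elim: s => [|i s IH]; first by rewrite big_nil.
by rewrite big_cons -[leLHS]mulr1 ler_pM.
Qed.

Lemma partial_product_ge1 J t : 0 <= t -> 1 <= partial_product J t.
Proof. by move=> t0; apply: prod_ge1 => i; exact: factor_ge1. Qed.

Lemma partial_product_le I J t : 0 <= t -> (I <= J)%N ->
  partial_product I t <= partial_product J t.
Proof.
move=> t0 IJ; rewrite /partial_product (big_cat_nat (leq0n I) IJ)/=.
rewrite ler_peMr//; first by rewrite (le_trans ler01)//; exact: partial_product_ge1.
by apply: prod_ge1 => i; exact: factor_ge1.
Qed.

Lemma ler_prod_expR_sum (t : R) m n : 0 <= t ->
  \prod_(m <= j < n) (1 + b j * t) <= expR (t * \sum_(m <= j < n) b j).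
Proof.
move=> t0; rewrite mulr_sumr expR_sum; apply: ler_prod => i _.
by rewrite (le_trans ler01) ?factor_ge1//= mulrC expR_ge1Dx.
Qed.

Lemma sum_tail_le n : \sum_(0 <= j < n) b j <= b 0%N + c * b 1%N.
Proof.
have c0 : 0 <= c * b 1%N.
  by have := @b_tail 1%N 0%N isT; rewrite big_geq// mulr1.
case: n => [|n]; first by rewrite big_geq// addr_ge0// ltW.
rewrite big_nat_recl//= lerD2l.
by have := @b_tail 1%N n.+1 isT; rewrite big_add1/= mulr1.
Qed.

Lemma partial_product_bounded J t : 0 <= t ->
  partial_product J t <= expR (t * (b 0%N + c * b 1%N)).
Proof.
move=> t0; apply: le_trans (ler_prod_expR_sum _ _ t0) _.
by rewrite ler_expR ler_wpM2l// sum_tail_le.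
Qed.

Lemma partial_product_ge J t p : 0 <= t -> (p <= J)%N ->
  \prod_(0 <= j < p) (b j * t) <= partial_product J t.
Proof.
move=> t0 pJ; apply: le_trans (partial_product_le t0 pJ); apply: ler_prod => i _.
by rewrite mulr_ge0 ?(ltW (b_gt0 _))//= lerDr.
Qed.

Lemma partial_product_cvg t : 0 <= t -> cvgn (partial_product ^~ t).
Proof.
move=> t0; apply: nondecreasing_is_cvgn.
  by move=> I J IJ; exact: partial_product_le.
by exists (expR (t * (b 0%N + c * b 1%N))) => _ [J _ <-]; exact: partial_product_bounded.
Qed.

Definition product_poly J : {poly R} := \prod_(0 <= j < J) (1 + (b j)%:P * 'X).

Lemma product_polyE J t : (product_poly J).[t] = partial_product J t.
Proof.
rewrite /product_poly horner_prod; apply: eq_bigr => j _.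
by rewrite !hornerE.
Qed.

Lemma product_poly_coef_ge0 J m : 0 <= (product_poly J)`_m.
Proof.
elim: J m => [|J IH] m; first by rewrite /product_poly big_geq// coef1 ler0n.
rewrite /product_poly big_nat_recr//= -/(product_poly J) mulrDr mulr1 mulrCA.
rewrite coefD coefCM coefMX addr_ge0//.
by rewrite mulr_ge0 ?(ltW (b_gt0 J))//; case: ifP.
Qed.

Lemma product_poly_coefM J m t : 0 <= t ->
  (product_poly J)`_m * t ^+ m <= partial_product J t.
Proof.
move=> t0; rewrite -product_polyE horner_coef.
have [mJ|Jm] := ltnP m (size (product_poly J)); last first.
  rewrite nth_default// mul0r sumr_ge0// => i _.
  by rewrite mulr_ge0 ?product_poly_coef_ge0 ?exprn_ge0.
rewrite (bigD1 (Ordinal mJ))//= lerDl sumr_ge0// => i _.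
by rewrite mulr_ge0 ?product_poly_coef_ge0 ?exprn_ge0.
Qed.

(** The tail condition enters here.  At [t = 1 / b m] the [m]-th coefficient
    times [t ^ m] is at most the product, in which a factor of index [j < m] is
    at most [2 b_j / b_m], whereas the remaining factors are bounded together by
    [exp (sum_(j >= m) b_j / b_m) <= exp (c m)]. *)
Lemma product_poly_coef_le J m :
  (product_poly J)`_m <= (2 * expR c) ^+ m * \prod_(0 <= j < m) b j.
Proof.
case: m => [|m].
  have := product_poly_coefM J 0 (lexx 0); rewrite expr0 mulr1 => /le_trans -> //.
  rewrite expr0 big_geq// mulr1 /partial_product big1// => j _.
  by rewrite mulr0 addr0.
set p := m.+1; have bp := b_gt0 p.
have t0 : 0 <= (b p)^-1 by rewrite invr_ge0 ltW.
rewrite -[leLHS](mulfK (_ : (b p)^-1 ^+ p != 0)); last by rewrite expf_neq0// invr_neq0// gt_eqF.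
rewrite -exprVn invrK -ler_pdivlMr ?exprn_gt0//.
apply: le_trans (product_poly_coefM J p t0) _.
apply: le_trans (partial_product_le t0 (leq_addl p J)) _.
(* The [p] extra factors only serve to make the product longer than [p]. *)
rewrite /partial_product (big_cat_nat (leq0n p) (leq_addr J p))/= addnC.
apply: (@le_trans _ _ (\prod_(0 <= j < p) (2 * (b j / b p)) * expR c ^+ p)).
  rewrite ler_pM//.
  - by apply: prodr_ge0 => j _; rewrite (le_trans ler01)// factor_ge1.
  - by apply: prodr_ge0 => j _; rewrite (le_trans ler01)// factor_ge1.
  - rewrite big_nat_cond [leRHS]big_nat_cond; apply: ler_prod => j /andP[/andP[_ jp] _].
    rewrite (le_trans ler01) ?factor_ge1//= mulr_natl mulr2n lerD2r.
    by rewrite ler_pdivlMr// mul1r b_noninc// ltnW.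
  - apply: le_trans (ler_prod_expR_sum _ _ t0) _.
    rewrite -expRM_natl ler_expR mulrC ler_pdivrMr//.
    by rewrite [p%:R * c]mulrC; exact: b_tail.
rewrite big_split/= big_split/= !prodr_const_nat subn0 -exprVn exprMn.
apply: eq_ler.
by move: (2 ^+ p) (\prod_(0 <= j < p) b j) ((b p)^-1 ^+ p) (expR c ^+ p) => *; ring.
Qed.

(** The infinite product is a power series whose coefficients inherit the
    bound.  The dominating series [sum_m G m t^m] converges because
    [prod_(j < m) b_j T] is at most the bounded infinite product at [T]; with
    [T] twice the argument needed this gains a factor [2 ^ - m]. *)
Lemma canonical_product_series : exists q : nat -> R,
  (forall p, `|q p| <= (2 * expR c) ^+ p * \prod_(0 <= j < p) b j) /\
  (forall t, 0 <= t -> pseries q t @ \oo --> limn (partial_product ^~ t)).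
Proof.
pose e J m := (product_poly J)`_m.
pose G m := (2 * expR c) ^+ m * \prod_(0 <= j < m) b j.
have eG J m : `|e J m| <= G m.
  by rewrite ger0_norm ?product_poly_coef_ge0// product_poly_coef_le.
have [q [qG _ ql]] := pseries_coef_compact eG.
exists q; split; first exact: qG.
move=> t t0.
have vl : (fun J => partial_product J t) @ \oo --> limn (partial_product ^~ t).
  by have := partial_product_cvg t0.
apply: (ql t (fun J => partial_product J t) _ _ _ vl) => [|J]; last first.
  rewrite -product_polyE; apply: cvg_near_cst.
  exists (size (product_poly J)) => // n /= Jn.
  rewrite /pseries /series/= (big_cat_nat (leq0n _) Jn)/= -[RHS]addr0; congr (_ + _).
    by rewrite horner_coef big_mkord.
  by rewrite big_nat_cond big1// => i /andP[/andP[Ji _] _]; rewrite /e nth_default// mul0r.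
pose T := 2 * (2 * expR c) * t.
have T0 : 0 <= T by rewrite !mulr_ge0// expR_ge0.
apply: (@series_le_cvg _ _ (geometric (expR (T * (b 0%N + c * b 1%N))) (2^-1))).
- by move=> n; rewrite mulr_ge0 ?exprn_ge0// (le_trans _ (eG 0%N n)).
- by move=> n; rewrite /geometric/= mulr_ge0 ?expR_ge0// exprn_ge0.
- move=> n; rewrite /geometric/= (ger0_norm t0).
  have := le_trans (partial_product_ge T0 (leqnn n)) (partial_product_bounded n T0).
  rewrite big_split/= prodr_const_nat subn0 => H.
  rewrite -ler_pdivrMr ?exprn_gt0// exprVn invrK; apply: le_trans H.
  rewrite /G /T !exprMn; apply: eq_ler.
  by move: (\prod_(0 <= j < n) b j) (2 ^+ n) (expR c ^+ n) (t ^+ n) => *; ring.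
by apply: is_cvg_geometric_series; rewrite gtr0_norm// invf_lt1// ltr1n.
Qed.

End canonical_product.

(** * The germ of the reciprocal of a canonical product *)

Section factor_germs.
Variables (R : realType) (r : R).
Hypothesis r_gt0 : 0 < r.

Lemma wiener_sub (x : R) : wiener r (fun y => y - x) x r.
Proof.
have := wiener_shift r_gt0 (wiener_cst r 1 x); rewrite normr1 mulr1.
by apply: wiener_ext => s _; rewrite mulr1.
Qed.

Lemma wiener_id (x : R) : wiener r id x (`|x| + r).
Proof.
apply: wiener_ext (wienerD r_gt0 (wiener_cst r x x) (wiener_sub x)) => s _ /=.
by ring.
Qed.

(** The norm of [y ^ n - x ^ n] is at most the same difference for the norms of
    [y] and [x], because its expansion in powers of [y - x] has coefficients
    bounded by those obtained for [|x|], which are nonnegative. *)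
Lemma wiener_subXn (x : R) n :
  wiener r (fun y => y ^+ n - x ^+ n) x ((`|x| + r) ^+ n - `|x| ^+ n).
Proof.
elim: n => [|n IH].
  have := wiener_cst r 0 x; rewrite normr0 expr0 subrr.
  by apply: wiener_ext => s _; rewrite ?expr0 ?subrr.
have W := wienerD r_gt0 (wienerM r_gt0 (wiener_id x) IH)
  (wienerZ (x ^+ n) (wiener_sub x)).
apply: wiener_ext (wiener_le _ W) => [s _|].
  by rewrite !exprS; ring.
by rewrite normrX !exprS; apply: eq_ler; ring.
Qed.

(** Neumann series for the inverse of [1 + b y^n = g (1 + (b / g) (y^n - x^n))], where
    [g = 1 + b x^n] is the value at the centre. *)
Lemma wiener_inv_factor (x b : R) n : 0 <= b -> ~~ odd n ->
  0 < 1 + 2 * b * x ^+ n - b * (`|x| + r) ^+ n ->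
  wiener r (fun y => (1 + b * y ^+ n)^-1) x
    (1 + 2 * b * x ^+ n - b * (`|x| + r) ^+ n)^-1.
Proof.
move=> b0 n_even d0; have xn0 : 0 <= x ^+ n by rewrite exprn_even_ge0.
have xnE : `|x| ^+ n = x ^+ n by rewrite -normrX ger0_norm.
set g := 1 + b * x ^+ n; have g0 : 0 < g by rewrite ltr_pwDl// mulr_ge0.
have gn0 : g != 0 by rewrite gt_eqF.
set th := b / g * ((`|x| + r) ^+ n - `|x| ^+ n).
have dE : 1 + 2 * b * x ^+ n - b * (`|x| + r) ^+ n = g * (1 - th).
  by rewrite /th xnE mulrBr mulr1 mulrA mulrCA divff// /g; ring.
rewrite dE invfM; rewrite dE pmulr_rgt0// subr_gt0 in d0.
have W : wiener r (fun y => - (b / g) * (y ^+ n - x ^+ n)) x th.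
  have -> : th = `|- (b / g)| * ((`|x| + r) ^+ n - `|x| ^+ n).
    by rewrite normrN ger0_norm// divr_ge0// ltW.
  exact: wienerZ (wiener_subXn x n).
have := wienerZ g^-1 (wiener_inv1B r_gt0 W d0).
rewrite gtr0_norm ?invr_gt0//; apply: wiener_ext => s _.
by rewrite -invfM mulrBr mulr1 mulrA mulrN mulrCA divff// mulr1 /g; congr (_^-1); ring.
Qed.

End factor_germs.

Section product_germ.
Variables (R : realType) (b : nat -> R) (c r : R) (n : nat).
Hypothesis b_gt0 : forall j, 0 < b j.
Hypothesis b_tail : forall p k, (0 < p)%N ->
  \sum_(p <= j < k) b j <= c * p%:R * b p.
Hypothesis r_gt0 : 0 < r.
Hypothesis n_even : ~~ odd n.
(* From [|x| >= 3 n r] on, the Bernoulli inequality shows that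
   [(|x| + r) ^ n] is at most [3/2 x ^ n]. *)
Let X0 := 3 * n%:R * r.
Let A := (X0 + r) ^+ n.
Hypothesis b_small : forall j, b j * (2 * A) <= 1.

Let X0_ge0 : 0 <= X0. Proof. by rewrite !mulr_ge0// ltW. Qed.
Let A_gt0 : 0 < A. Proof. by rewrite exprn_gt0// ltr_pwDr. Qed.

Lemma bernoulli_le (t : R) m : 0 <= t -> t <= 1 -> 1 - m%:R * t <= (1 - t) ^+ m.
Proof.
move=> t0 t1; elim: m => [|m IH]; first by rewrite expr0 mul0r subr0.
have t1' : 0 <= 1 - t by rewrite subr_ge0.
rewrite exprS; apply: le_trans (ler_wpM2l t1' IH).
have -> : (1 - t) * (1 - m%:R * t) = 1 - m.+1%:R * t + m%:R * t ^+ 2.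
  by rewrite -natr1; ring.
by rewrite lerDl mulr_ge0// sqr_ge0.
Qed.

Lemma translate_exprn_le (x : R) : X0 <= `|x| ->
  (`|x| + r) ^+ n <= 3 / 2 * x ^+ n.
Proof.
move=> Xx; set y := `|x| + r.
have y0 : 0 < y by rewrite ltr_pwDr.
have xnE : x ^+ n = `|x| ^+ n by rewrite -normrX ger0_norm// exprn_even_ge0.
have -> : x ^+ n = y ^+ n * (1 - r / y) ^+ n.
  rewrite xnE -exprMn mulrBr mulr1 mulrCA divff ?gt_eqF// mulr1; congr (_ ^+ _).
  by rewrite /y addrK.
have ry : n%:R * (r / y) <= 1 / 3.
  have Xy : 3 * n%:R * r <= y by apply: le_trans Xx _; rewrite lerDl ltW.
  by rewrite mulrA ler_pdivrMr//; lra.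
have yn0 : 0 < y ^+ n by rewrite exprn_gt0.
have H := @bernoulli_le (r / y) n _ _.
rewrite mulrCA -[leLHS]mulr1 ler_pM2l//.
have : 1 - n%:R * (r / y) <= (1 - r / y) ^+ n.
  by apply: H; rewrite ?divr_ge0 ?(ltW r_gt0) ?(ltW y0)// ler_pdivrMr// mul1r lerDr.
lra.
Qed.

Let u (x : R) j := (1 + 2 * b j * x ^+ n - b j * (`|x| + r) ^+ n)^-1.

Lemma denominator_large (x : R) j : X0 <= `|x| ->
  1 + b j * x ^+ n / 2 <= 1 + 2 * b j * x ^+ n - b j * (`|x| + r) ^+ n.
Proof.
move=> /translate_exprn_le H; have := ler_wpM2l (ltW (b_gt0 j)) H; lra.
Qed.

Lemma denominator_small (x : R) j : `|x| <= X0 ->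
  1 - b j * A <= 1 + 2 * b j * x ^+ n - b j * (`|x| + r) ^+ n.
Proof.
move=> xX; have xn0 : 0 <= x ^+ n by rewrite exprn_even_ge0.
have H : (`|x| + r) ^+ n <= A.
  by rewrite /A lerXn2r ?nnegrE ?addr_ge0 ?(ltW r_gt0)// lerD2r.
have := ler_wpM2l (ltW (b_gt0 j)) H; have := mulr_ge0 (ltW (b_gt0 j)) xn0; lra.
Qed.

Lemma denominator_gt0 (x : R) j : 0 < 1 + 2 * b j * x ^+ n - b j * (`|x| + r) ^+ n.
Proof.
have [xX|/ltW xX] := leP X0 `|x|.
  apply: lt_le_trans (denominator_large j xX).
  by rewrite ltr_pwDl// !mulr_ge0 ?exprn_even_ge0 ?(ltW (b_gt0 j)).
by apply: lt_le_trans (denominator_small j xX); have := b_small j; lra.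
Qed.

Let C := expR (2 * A * (b 0%N + c * b 1%N)).

(** For large [|x|] each factor is at most the inverse of [1 + b_j x^n / 2],
    whose square exceeds [1 + b_j x^n], so that the square of the left-hand side
    is at most the inverse of the partial product, which is controlled by
    [W ^ 2].  For the other [x] the bound [W] is at least 1 since every
    [b_j x^n] is at most 1, and the left-hand side is at most [C] because
    [1 / (1 - v) <= 1 + 2 v] for [v <= 1/2]. *)
Lemma prod_factor_bound_le (x W : R) p J : 0 <= W -> (p <= J)%N ->
  1 <= W ^+ 2 * \prod_(0 <= j < p) (b j * x ^+ n) ->
  \prod_(0 <= j < J) u x j <= C * W.
Proof.
move=> W0 pJ HW; have xn0 : 0 <= x ^+ n by rewrite exprn_even_ge0.
have c0 : 0 <= c * b 1%N.
  by have := @b_tail 1%N 0%N isT; rewrite big_geq// mulr1.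
have C1 : 1 <= C.
  by rewrite -expR0 ler_expR !mulr_ge0 ?addr_ge0 ?(ltW (b_gt0 0))// ltW.
have u0 j : 0 <= u x j by rewrite invr_ge0 ltW// denominator_gt0.
have [xX|/ltW xX] := leP X0 `|x|.
- apply: (@le_trans _ _ W); last by rewrite ler_peMl.
  rewrite -(@ler_pXn2r _ 2)// ?nnegrE ?prodr_ge0//.
  have P0 : 0 < \prod_(0 <= j < p) (b j * x ^+ n).
    rewrite ltNge; apply/negP => P0; move: HW.
    by rewrite leNgt (le_lt_trans _ ltr01)// mulr_ge0_le0// sqr_ge0.
  rewrite -prodrXl -(ler_pM2r P0); apply: le_trans HW.
  have pp := partial_product_ge b_gt0 xn0 pJ.
  apply: (@le_trans _ _ ((\prod_(0 <= j < J) u x j ^+ 2) * partial_product b J (x ^+ n))).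
    by rewrite ler_wpM2l// prodr_ge0// => i _; rewrite sqr_ge0.
  rewrite /partial_product -big_split/=.
  apply: prodr_ile1 => j _; apply/andP; split.
    by rewrite mulr_ge0 ?sqr_ge0// addr_ge0// mulr_ge0// ltW.
  have D := denominator_large j xX; have D0 := denominator_gt0 x j.
  have bx : 0 <= b j * x ^+ n by rewrite mulr_ge0// ltW.
  rewrite /u exprVn mulrC ler_pdivrMr ?exprn_gt0// mul1r.
  apply: le_trans (_ : (1 + b j * x ^+ n / 2) ^+ 2 <= _); last first.
    by rewrite lerXn2r ?nnegrE ?(ltW D0)// addr_ge0 ?divr_ge0.
  by have := sqr_ge0 (b j * x ^+ n / 2); rewrite sqrrD expr1n; lra.
- have W1 : 1 <= W.
    rewrite -(@ler_pXn2r _ 2)// ?nnegrE// expr1n; apply: le_trans HW _.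
    rewrite ler_piMr ?sqr_ge0//; apply: prodr_ile1 => j _.
    rewrite mulr_ge0 ?(ltW (b_gt0 j))//=.
    apply: le_trans (b_small j); rewrite ler_wpM2l ?(ltW (b_gt0 j))//.
    have xA : x ^+ n <= A.
      have -> : x ^+ n = `|x| ^+ n by rewrite -normrX ger0_norm.
      by rewrite /A lerXn2r ?nnegrE ?addr_ge0 ?(ltW r_gt0)// (le_trans xX)// lerDl ltW.
    by have := A_gt0; lra.
  apply: le_trans (_ : C <= _); last by rewrite ler_peMr// (le_trans ler01).
  have A20 : 0 <= 2 * A by rewrite mulr_ge0// ltW.
  apply: le_trans (partial_product_bounded b_gt0 b_tail J A20).
  apply: ler_prod => j _; rewrite u0/=.
  have D := denominator_small j xX; have D0 := denominator_gt0 x j.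
  rewrite /u -[_^-1]mul1r ler_pdivrMr//.
  have bA : 0 <= b j * A by rewrite mulr_ge0// ltW.
  have F0 : 0 <= 1 + b j * (2 * A) by rewrite addr_ge0// mulr_ge0// ltW.
  apply: le_trans (ler_wpM2l F0 D).
  have bA1 : 0 <= 1 - b j * (2 * A) by rewrite subr_ge0.
  have := mulr_ge0 bA bA1; lra.
Qed.

Definition inv_product (x : R) : R := (limn (partial_product b ^~ (x ^+ n)))^-1.

Lemma limn_partial_product_gt0 (t : R) : 0 <= t -> 0 < limn (partial_product b ^~ t).
Proof.
move=> t0; apply: lt_le_trans ltr01 _; apply: (limr_ge (partial_product_cvg b_gt0 b_tail t0)).
by apply: nearW => J; exact: partial_product_ge1.
Qed.

(** The index [p] shifts the partial products, since only those with at least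
    [p] factors satisfy the bound. *)
Lemma wiener_inv_product (x W : R) p : 0 <= W ->
  1 <= W ^+ 2 * \prod_(0 <= j < p) (b j * x ^+ n) ->
  wiener r inv_product x (C * W).
Proof.
move=> W0 HW.
apply: (@wiener_lim _ _ r_gt0
  (fun J y => \prod_(0 <= j < J + p) (1 + b j * y ^+ n)^-1)) => [J|s sr].
  apply: wiener_le (prod_factor_bound_le W0 (leq_addl J p) HW) _.
  apply: wiener_prod => // j; apply: wiener_inv_factor => //; first exact: ltW.
  exact: denominator_gt0.
have t0 : 0 <= (x + s) ^+ n by rewrite exprn_even_ge0.
under eq_fun do rewrite prodfV.
apply: cvgV; first by rewrite gt_eqF// limn_partial_product_gt0.
have K : partial_product b ^~ ((x + s) ^+ n) @ \oo -->
    limn (partial_product b ^~ ((x + s) ^+ n)).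
  by have := partial_product_cvg b_gt0 b_tail t0.
by rewrite -(cvg_shiftn p) in K.
Qed.

Lemma inv_product_is_derive (x : R) m :
  is_derive x (1 : R) (derive1n m inv_product) (derive1n m.+1 inv_product x).
Proof.
apply: (wiener_is_derive r_gt0 m (@wiener_inv_product x 1 0 _ _)) => //.
by rewrite big_geq// expr1n mulr1.
Qed.

Lemma inv_product_derive1n_le (x W : R) m p : 0 <= W ->
  1 <= W ^+ 2 * \prod_(0 <= j < p) (b j * x ^+ n) ->
  `|derive1n m inv_product x| <= m`!%:R / r ^+ m * (C * W).
Proof.
by move=> W0 HW; apply: wiener_derive1n_le => //; exact: wiener_inv_product HW.
Qed.

End product_germ.

(** * Reciprocals of canonical products with prescribed decay *)

Section truncation.
Variables (R : realType) (b : nat -> R) (c beta : R).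
Hypothesis b_gt0 : forall j, 0 < b j.
Hypothesis b_noninc : forall i j, (i <= j)%N -> b j <= b i.
Hypothesis c_ge0 : 0 <= c.
Hypothesis b_tail : forall p n, (0 < p)%N ->
  \sum_(p <= j < n) b j <= c * p%:R * b p.
Hypothesis beta_gt0 : 0 < beta.

(** A nonincreasing summable sequence tends to zero: [J b_J] is at most the sum
    of the terms of index 1 to [J]. *)
Lemma tail_eventually_le : exists J0, forall j, (J0 <= j)%N -> b j <= beta.
Proof.
have [J HJ] : exists J : nat, c * b 1%N / beta <= J%:R.
  exists (Num.truncn (c * b 1%N / beta)).+1; apply: ltW; exact: truncnS_gt.
exists J.+1 => j Jj; apply: le_trans (b_noninc Jj) _.
have H := @b_tail 1%N J.+2 isT; rewrite mulr1 in H.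
have : J.+1%:R * b J.+1 <= c * b 1%N.
  apply: le_trans H; rewrite -[J.+1]/(J.+2 - 1)%N mulr_natl -sumr_const_nat.
  rewrite big_nat_cond [leRHS]big_nat_cond; apply: ler_sum => i /andP[/andP[_ iJ] _].
  by apply: b_noninc.
rewrite ler_pdivrMr// in HJ => /le_trans/(_ HJ) {}H.
rewrite -(@ler_pM2l _ J.+1%:R)//; apply: le_trans H _.
by rewrite ler_wpM2r ?(ltW beta_gt0)// ler_nat.
Qed.

Let b' j := Num.min (b j) beta.

(** Only finitely many terms exceed [beta].  Where the cut-off is active, the
    sum consists of fewer than [J0] terms, none above [beta], and of the tail
    from [J0] on, which is at most [c * J0 * beta]. *)
Lemma truncated_tail : exists c', forall p n, (0 < p)%N ->
  \sum_(p <= j < n) b' j <= c' * p%:R * b' p.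
Proof.
have [J0 HJ0] := tail_eventually_le.
have J00 : 0 <= J0%:R :> R by [].
exists (c + J0%:R + c * J0%:R) => p n p0.
have p1 : 1 <= p%:R :> R by rewrite ler1n.
have b'b j : b' j <= b j by rewrite ge_min lexx.
have b'0 j : 0 <= b' j by rewrite le_min !ltW.
have b'beta j : b' j <= beta by rewrite ge_min lexx orbT.
have [bp|bp] := leP (b p) beta.
  have -> : b' p = b p by rewrite /b' min_l.
  apply: (@le_trans _ _ (\sum_(p <= j < n) b j)); first exact: ler_sum.
  apply: le_trans (b_tail _ p0) _; rewrite !ler_wpM2r ?(ltW (b_gt0 p))//.
  by rewrite -addrA lerDl addr_ge0// mulr_ge0.
have -> : b' p = beta by rewrite /b' min_r// ltW.
have pJ : (p < J0)%N by rewrite ltnNge; apply/negP => /HJ0; rewrite leNgt bp.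
have J01 : (0 < J0)%N by exact: leq_ltn_trans pJ.
apply: (@le_trans _ _ (\sum_(p <= j < n + J0) b' j)).
  have [np|pn] := leqP n p; first by rewrite big_geq// sumr_ge0.
  by rewrite (big_cat_nat (ltnW pn) (leq_addr J0 n))/= lerDl sumr_ge0.
rewrite (big_cat_nat (ltnW pJ) (leq_addl n J0))/=.
have S1 : \sum_(p <= j < J0) b' j <= J0%:R * beta.
  apply: (@le_trans _ _ (\sum_(p <= j < J0) beta)); first exact: ler_sum.
  by rewrite sumr_const_nat -[leLHS]mulr_natl ler_wpM2r ?(ltW beta_gt0)// ler_nat leq_subr.
have S2 : \sum_(J0 <= j < n + J0) b' j <= c * J0%:R * beta.
  apply: (@le_trans _ _ (\sum_(J0 <= j < n + J0) b j)); first exact: ler_sum.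
  by apply: le_trans (b_tail _ J01) _; rewrite ler_wpM2l ?mulr_ge0// HJ0.
apply: (@le_trans _ _ ((c + J0%:R + c * J0%:R) * 1 * beta)).
  by have := mulr_ge0 c_ge0 (ltW beta_gt0); lra.
by rewrite ler_wpM2r ?(ltW beta_gt0)// ler_wpM2l// !addr_ge0// mulr_ge0.
Qed.

(** Cutting off changes only finitely many factors, so that products of any
    length shrink by a bounded factor. *)
Lemma truncated_prod_ge : exists2 delta, 0 < delta <= 1 & forall p,
  delta * \prod_(0 <= j < p) b j <= \prod_(0 <= j < p) b' j.
Proof.
have [J0 HJ0] := tail_eventually_le.
pose m j := Num.min 1 (beta / b j).
have m0 j : 0 < m j by rewrite lt_min ltr01 divr_gt0.
have m1 j : m j <= 1 by rewrite ge_min lexx.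
have m01 j : 0 <= m j <= 1 by rewrite m1 ltW.
have b'E j : b' j = m j * b j.
  by rewrite /b' /m minr_pMl ?(ltW (b_gt0 j))// mul1r divfK// gt_eqF.
exists (\prod_(0 <= j < J0) m j).
  by rewrite prodr_gt0//= prodr_ile1.
move=> p; under [leRHS]eq_bigr do rewrite b'E.
rewrite big_split/= ler_wpM2r//; first by rewrite prodr_ge0// => j _; exact: ltW.
have -> : \prod_(0 <= j < J0) m j = \prod_(0 <= j < p + J0) m j.
  rewrite [RHS](big_cat_nat (leq0n J0) (leq_addl p J0))/= -[LHS]mulr1; congr (_ * _).
  rewrite big_nat_cond big1// => j /andP[/andP[Jj _] _].
  by rewrite /m min_l// ler_pdivlMr// mul1r HJ0.
rewrite (big_cat_nat (leq0n p) (leq_addr J0 p))/= -[leRHS]mulr1 ler_wpM2l//.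
  by rewrite prodr_ge0// => j _; exact: ltW.
by rewrite prodr_ile1.
Qed.

End truncation.

Section one_variable.
Variables (R : realType) (B : nat -> R) (c kappa r : R) (N : nat).
Hypothesis B_gt0 : forall p, 0 < B p.
Hypothesis B0 : B 0%N = 1.
Let nu j := B j / B j.+1.
Hypothesis nu_noninc : forall i j, (i <= j)%N -> nu j <= nu i.
Hypothesis N_gt0 : (0 < N)%N.
Hypothesis c_ge0 : 0 <= c.
Hypothesis nu_tail : forall p n, (0 < p)%N ->
  \sum_(p <= j < n) nu j ^+ N.*2 <= c * p%:R * nu p ^+ N.*2.
Hypothesis kappa_gt0 : 0 < kappa.
Hypothesis r_gt0 : 0 < r.

Lemma prod_ratio p : \prod_(0 <= j < p) (kappa * nu j) = kappa ^+ p / B p.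
Proof.
rewrite big_split/= prodr_const_nat subn0; congr (_ * _).
elim: p => [|p IH]; first by rewrite big_geq// B0 invr1.
by rewrite big_nat_recr//= IH /nu mulKf// gt_eqF.
Qed.

(** The one-variable heart of the matter, stated for an arbitrary weight [B]
    with nonincreasing ratios.  The function [h] is the reciprocal of the entire
    function with Taylor coefficients [q]; its decay is expressed by one
    inequality for each [p], which is equivalent to the bound by the associated
    function of [B]. *)
Theorem one_variable_product : exists (q : nat -> R) (h : R -> R) (L C : R),
  [/\ 0 < L, 0 < C, forall p, `|q p| <= L ^+ p / B p ^+ N.*2,
     forall x, 0 < h x /\ pseries q (x ^+ N.*2) @ \oo --> (h x)^-1
   & (forall m x, is_derive x (1 : R) (derive1n m h) (derive1n m.+1 h x)) /\
     (forall m x, `|derive1n m h x| <= C * (m`!%:R / r ^+ m) /\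
       forall p, `|derive1n m h x| * (kappa * `|x|) ^+ p <= C * (m`!%:R / r ^+ m) * B p)].
Proof.
pose n := N.*2.
pose b0 j := (kappa * nu j) ^+ n.
have nu0 j : 0 < nu j by rewrite divr_gt0.
have b00 j : 0 < b0 j by rewrite exprn_gt0// mulr_gt0.
have b0_noninc i j : (i <= j)%N -> b0 j <= b0 i.
  move=> ij; rewrite lerXn2r ?nnegrE ?(ltW (mulr_gt0 kappa_gt0 (nu0 _)))//.
  by rewrite ler_pM2l// nu_noninc.
have b0_tail p k : (0 < p)%N -> \sum_(p <= j < k) b0 j <= c * p%:R * b0 p.
  move=> p0; rewrite /b0; under eq_bigr do rewrite exprMn.
  by rewrite -mulr_sumr exprMn mulrCA ler_wpM2l ?exprn_ge0 ?(ltW kappa_gt0)// nu_tail.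
pose A := (3 * n%:R * r + r) ^+ n.
have A0 : 0 < A by rewrite exprn_gt0// ltr_pwDr// !mulr_ge0// ltW.
pose beta := (2 * A)^-1.
have beta0 : 0 < beta by rewrite invr_gt0 mulr_gt0.
pose b j := Num.min (b0 j) beta.
have b_gt0 j : 0 < b j by rewrite lt_min b00.
have b_noninc i j : (i <= j)%N -> b j <= b i.
  by move=> ij; rewrite le_min !ge_min b0_noninc// lexx orbT.
have [c' b_tail] : exists c', forall p k, (0 < p)%N -> \sum_(p <= j < k) b j <= c' * p%:R * b p.
  exact: (truncated_tail b00 b0_noninc c_ge0 b0_tail beta0).
have [delta /andP[d0 d1] Hd] := truncated_prod_ge b00 b0_noninc b0_tail beta0.
have n_even : ~~ odd n by rewrite odd_double.
have b_small j : b j * (2 * A) <= 1.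
  by rewrite -ler_pdivlMr ?mulr_gt0// div1r ge_min lexx orbT.
have [q [qb qs]] := canonical_product_series b_gt0 b_noninc b_tail.
set C0 := expR (2 * A * (b 0%N + c' * b 1%N)).
have C00 : 0 < C0 by exact: expR_gt0.
have HB := inv_product_derive1n_le b_gt0 b_tail r_gt0 n_even b_small.
exists q, (inv_product b n), (2 * expR c' * kappa ^+ n), (C0 / delta); split.
- by rewrite !mulr_gt0 ?expR_gt0 ?exprn_gt0.
- by rewrite divr_gt0.
- move=> p; apply: le_trans (qb p) _.
  rewrite [leRHS](_ : _ = (2 * expR c') ^+ p * (kappa ^+ p / B p) ^+ n); last first.
    by rewrite exprMn expr_div_n -!exprM mulnC mulrA.
  rewrite ler_wpM2l ?exprn_ge0 ?mulr_ge0 ?expR_ge0// -prod_ratio -prodrXl.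
  by apply: ler_prod => j _; rewrite (ltW (b_gt0 j))/= ge_min lexx.
- move=> x; have t0 : 0 <= x ^+ n by rewrite exprn_even_ge0.
  split; first by rewrite invr_gt0 (limn_partial_product_gt0 b_gt0 b_tail).
  by rewrite invrK; exact: qs.
- split=> [m x|m x]; first exact: (inv_product_is_derive b_gt0 b_tail r_gt0 n_even b_small).
  set F := m`!%:R / r ^+ m.
  have F0 : 0 <= F by rewrite divr_ge0 ?exprn_ge0// ltW.
  have CF : C0 * F <= C0 / delta * F.
    by rewrite ler_wpM2r// ler_peMr ?(ltW C00)// invf_ge1.
  have H1 : `|derive1n m (inv_product b n) x| <= C0 * F.
    have := HB x 1 m 0%N ler01; rewrite big_geq// expr1n mulr1 => /(_ (lexx _)).
    by rewrite mulr1 mulrC.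
  split=> [|p]; first exact: le_trans H1 CF.
  set xi := (kappa * `|x|) ^+ p / B p.
  have -> : (kappa * `|x|) ^+ p = xi * B p by rewrite /xi divfK// gt_eqF.
  rewrite mulrA ler_pM2r//.
  have kx0 : 0 <= kappa * `|x| by rewrite mulr_ge0// ltW.
  have xi0 : 0 <= xi by rewrite divr_ge0 ?exprn_ge0// ltW.
  (* If [xi <= 1] the bound without weight suffices; otherwise
     [W = 1 / (delta * xi)] is an admissible weight because [n >= 2]. *)
  have [xi1|/ltW xi1] := leP xi 1.
    apply: le_trans CF; apply: le_trans H1.
    by rewrite ler_piMr.
  have xip : 0 < xi by exact: lt_le_trans ltr01 xi1.
  rewrite -ler_pdivlMr//.
  rewrite [leRHS](_ : _ = F * (C0 * (delta^-1 / xi))); last by rewrite mulrC; ring.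
  apply: (HB x (delta^-1 / xi) m p); first by rewrite divr_ge0 ?invr_ge0 ?(ltW d0).
  rewrite big_split/= prodr_const_nat subn0.
  apply: (@le_trans _ _ ((delta^-1 / xi) ^+ 2 * (delta * xi ^+ n))); last first.
    rewrite ler_wpM2l ?sqr_ge0//.
    have -> : xi ^+ n = \prod_(0 <= j < p) b0 j * (x ^+ n) ^+ p.
      have -> : x ^+ n = `|x| ^+ n by rewrite -normrX ger0_norm// exprn_even_ge0.
      by rewrite /b0 prodrXl prod_ratio [X in _ * X]exprAC /xi
        [(kappa * _) ^+ p]exprMn mulrAC exprMn.
    have xn0 : 0 <= x ^+ n by rewrite exprn_even_ge0.
    by rewrite mulrA; apply: ler_wpM2r; [exact: exprn_ge0|exact: Hd].
  have -> : (delta^-1 / xi) ^+ 2 * (delta * xi ^+ n) = delta^-1 * xi ^+ (N.-1.*2).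
    have -> : n = (2 + N.-1.*2)%N by rewrite /n -{1}(prednK N_gt0) doubleS.
    by rewrite exprD; field; rewrite !gt_eqF.
  by rewrite -[leLHS]mulr1 ler_pM// ?invf_ge1// exprn_ege1.
Qed.

End one_variable.

(** * Partial derivatives of products of one-variable functions *)

Section partial_of_products.
Variables (R : realType) (d : nat).
Implicit Types (x y : 'rV[R]_d) (alpha : {ffun 'I_d -> nat}).

(** Along a coordinate direction only one factor moves. *)
Lemma derive_coordinate_prod (g : 'I_d -> R -> R) (i : 'I_d) x (l : R) :
  is_derive (x 0 i) (1 : R) (g i) l ->
  'D_(delta_mx 0 i) (fun y : 'rV[R]_d => \prod_j g j (y 0 j)) x =
    l * \prod_(j | j != i) g j (x 0 j).
Proof.
move=> gl; set K := \prod_(j | j != i) _.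
have D : is_derive (x 0 i) (1 : R) (fun t => K * g i t) (K * l).
  exact: (@is_deriveZ R R R (g i) K (x 0 i) 1 l gl).
have [_ <-] : is_derive (x 0 i) (1 : R) (fun t => K * g i t) (l * K) by rewrite mulrC.
rewrite /derive; set u := fun t : R => _; set v := fun t : R => _.
suff -> : u = v by [].
apply/funext => t; rewrite /u /v /=; congr (_ *: (_ - _)).
- rewrite (bigD1 i)//= mulrC; congr (_ * g i _); last first.
    by rewrite !mxE !eqxx/= mulr1 scaler1.
  apply: eq_bigr => j ji; congr (g j _).
  by rewrite !mxE eqxx/= (negbTE ji) mulr0 add0r.
- by rewrite (bigD1 i)//= mulrC.
Qed.

Lemma partial_real (f : 'rV[R]_d -> R) i :
  partial i (fun y => (f y)%:C) = fun x => ('D_(delta_mx 0 i) f x)%:C.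
Proof.
apply/funext => x; rewrite /partial/= /real_complex_def; congr (_ +i* _).
exact: derive_cst.
Qed.

Variable h : nat -> R -> R.
Hypothesis h_derive : forall m (t : R), is_derive t (1 : R) (h m) (h m.+1 t).

Let F (beta : 'I_d -> nat) y : R[i] := (\prod_j h (beta j) (y 0 j))%:C.

Lemma partial_prod (beta : 'I_d -> nat) i :
  partial i (F beta) = F (fun j => beta j + (j == i))%N.
Proof.
rewrite partial_real; apply/funext => x; rewrite /F; congr (_ %:C).
have E := @derive_coordinate_prod (fun j => h (beta j)) i x _ (h_derive (beta i) (x 0 i)).
rewrite [LHS]E.
rewrite [RHS](bigD1 i)//= eqxx addn1; congr (_ * _).
by apply: eq_bigr => j ji; rewrite (negbTE ji) addn0.
Qed.

Lemma iter_partial_prod k (beta : 'I_d -> nat) i :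
  iter k (partial i) (F beta) = F (fun j => beta j + (j == i) * k)%N.
Proof.
elim: k => [|k IH] /=.
  by congr F; apply/funext => j; rewrite muln0 addn0.
rewrite IH partial_prod; congr F; apply/funext => j.
by rewrite -addnA mulnS [(_ * k + _)%N]addnC.
Qed.

(** Mixed partial derivatives are iterated one coordinate after the other; the
    intermediate multi-indices agree with [alpha] on the coordinates already
    treated and vanish on the others. *)
Lemma mpartial_prod alpha :
  mpartial alpha (F (fun=> 0%N)) = F alpha.
Proof.
rewrite /mpartial.
have -> : F alpha = F (fun j => if j \in enum 'I_d then alpha j else 0%N).
  by congr F; apply/funext => j; rewrite mem_enum.
have := enum_uniq 'I_d; elim: (enum 'I_d) => [_ //|i s IH] /= /andP[iNs us].
rewrite IH// iter_partial_prod; congr F; apply/funext => j.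
rewrite in_cons; case: eqVneq => [->|_] /=; first by rewrite (negbTE iNs) add0n mul1n.
by rewrite mul0n addn0.
Qed.

End partial_of_products.

Section complex_norm.
Variable R : realType.

Lemma normc_real (t : R) : `|t%:C| = `|t|%:C :> R[i].
Proof. by rewrite normc_def/= expr0n/= addr0 sqrtr_sqr. Qed.

Lemma norm_D_real d (alpha : {ffun 'I_d -> nat}) (f : 'rV[R]_d -> R[i]) x (t : R) :
  mpartial alpha f x = t%:C -> `|D alpha f x| = `|t|%:C.
Proof.
move=> E; rewrite /D E normrM normrX normc_real.
have -> : `|0 -i* 1 : R[i]| = 1 by rewrite normc_def/= expr0n/= sqrrN expr1n add0r sqrtr1.
by rewrite expr1n mul1r.
Qed.

End complex_norm.

(** * Unconditional summation of products of series *)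

Section unconditional_product.
Variables (K : numFieldType) (d : nat).
Implicit Types (alpha : {ffun 'I_d -> nat}).
Local Open Scope fset_scope.
Local Open Scope ring_scope.

Definition multi_of (n : nat) (f : {ffun 'I_d -> 'I_n}) : {ffun 'I_d -> nat} :=
  [ffun i => val (f i)].

(** The finite set of multi-indices with all entries below [n]: these sets are
    cofinal, and sums of products over them factor. *)
Definition box n : {fset {ffun 'I_d -> nat}} :=
  seq_fset tt [seq multi_of f | f <- enum {: {ffun 'I_d -> 'I_n}}].

Lemma multi_of_inj n : injective (@multi_of n).
Proof.
move=> f g fg; apply/ffunP => i; apply: val_inj.
by have := congr1 (fun u : {ffun 'I_d -> nat} => u i) fg; rewrite !ffunE.
Qed.

Lemma in_box n alpha : (alpha \in box n) = [forall i, (alpha i < n)%N].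
Proof.
rewrite seq_fsetE; apply/mapP/forallP => [[f _ ->] i|an].
  by rewrite /multi_of ffunE ltn_ord.
exists [ffun i => Ordinal (an i)]; first by rewrite mem_enum.
by apply/ffunP => i; rewrite !ffunE.
Qed.

Lemma sum_box n (G : {ffun 'I_d -> nat} -> K) :
  \sum_(alpha <- box n) G alpha = \sum_(f : {ffun 'I_d -> 'I_n}) G (multi_of f).
Proof.
rewrite -big_enum -[RHS](big_map (@multi_of n) xpredT G).
apply: perm_big; apply: uniq_perm; first exact: fset_uniq.
  by rewrite map_inj_uniq ?enum_uniq//; exact: multi_of_inj.
exact: seq_fsetE.
Qed.

Lemma sum_box_prod n (a : 'I_d -> nat -> K) :
  \sum_(alpha <- box n) \prod_i a i (alpha i) = \prod_i \sum_(0 <= k < n) a i k.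
Proof.
rewrite sum_box; under [RHS]eq_bigr do rewrite big_mkord.
rewrite bigA_distr_bigA/=; apply: eq_bigr => f _; apply: eq_bigr => i _.
by rewrite ffunE.
Qed.

Lemma box_bound (A : {fset {ffun 'I_d -> nat}}) : exists n, A `<=` box n.
Proof.
exists (\max_(alpha <- A) \max_i alpha i).+1; apply/fsubsetP => alpha alphaA.
rewrite in_box; apply/forallP => i; rewrite ltnS.
have := @leq_bigmax_seq _ _ xpredT (fun beta : {ffun 'I_d -> nat} => (\max_i beta i)%N)
  _ alphaA isT.
apply: leq_trans.
exact: (leq_bigmax i).
Qed.

Lemma sum_fsetD (A C : {fset {ffun 'I_d -> nat}}) (G : {ffun 'I_d -> nat} -> K) :
  A `<=` C -> \sum_(alpha <- C) G alpha - \sum_(alpha <- A) G alpha =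
    \sum_(alpha <- C `\` A) G alpha.
Proof.
move=> /fsubsetP AC.
have CE : perm_eq C (A ++ (C `\` A)).
  apply: uniq_perm => [||x]; first exact: fset_uniq.
    rewrite cat_uniq !fset_uniq andbT/=; apply/hasPn => x.
    by rewrite inE => /andP[].
  by rewrite mem_cat inE; case: (boolP (x \in A)) => //= /AC.
by rewrite [in LHS](perm_big _ CE)/= big_cat/= addrAC subrr add0r.
Qed.

(** For a finite set [A] between two boxes, the sum over [A] differs from the
    one over the smaller box by at most the difference of the corresponding
    products of sums of absolute values, which is small because these products
    converge.  This argument compares norms only through the order of [K], so it
    applies to the complex numbers, where norms are complex. *)
Lemma unconditional_product (a : 'I_d -> nat -> K) (S U : 'I_d -> K) :
  (forall i, series (a i) @ \oo --> S i) ->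
  (forall i, series (fun k => `|a i k|) @ \oo --> U i) ->
  partial_sum (fun alpha => \prod_i a i (alpha i)) @ totally
    --> ((\prod_i S i)%R : K^o).
Proof.
move=> aS aU.
have cvg_prod (s : 'I_d -> nat -> K) (l : 'I_d -> K) : (forall i, s i @ \oo --> l i) ->
    (fun n => \prod_i s i n) @ \oo --> \prod_i l i.
  move=> sl; elim: (index_enum _) => [|i e IH].
    by rewrite big_nil; under eq_fun do rewrite big_nil; exact: cvg_cst.
  by rewrite big_cons; under eq_fun do rewrite big_cons; apply: cvgM.
have sP := cvg_prod _ _ aS; have tP := cvg_prod _ _ aU.
have TF := @totally_filter {ffun 'I_d -> nat}.
apply/cvgrPdist_lt => e e0.
have e30 : 0 < e / 3 by rewrite divr_gt0.
have /cvgrPdist_lt/(_ _ e30)[n1 _ H1] := sP.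
have /cvgrPdist_lt/(_ _ e30)[n2 _ H2] := tP.
pose n := maxn n1 n2.
exists (box n) => // A /= nA.
have [m0 Am0] := box_bound A; pose m := maxn m0 n.
have Am : A `<=` box m.
  apply: fsubset_trans Am0 _; apply/fsubsetP => alpha; rewrite !in_box => /forallP H.
  by apply/forallP => i; rewrite (leq_trans (H i))// leq_maxl.
have nm : box n `<=` box m by exact: fsubset_trans nA Am.
pose x alpha := \prod_i a i (alpha i).
have D : `|\sum_(alpha <- A) x alpha - \sum_(alpha <- box n) x alpha| < e / 3 + e / 3.
  rewrite sum_fsetD//.
  apply: le_lt_trans (ler_norm_sum _ _ _) _.
  apply: (@le_lt_trans _ _ (\sum_(alpha <- box m `\` box n) `|x alpha|)).
    rewrite -subr_ge0 sum_fsetD ?fsetSD// sumr_ge0//.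
  rewrite -sum_fsetD//.
  have E k : \sum_(alpha <- box k) `|x alpha| = \prod_i series (fun k => `|a i k|) k.
    by rewrite -sum_box_prod; apply: eq_bigr => alpha _; rewrite normr_prod.
  have N2 k : (n <= k)%N -> `|\prod_i U i - \prod_i series (fun k => `|a i k|) k| < e / 3.
    by move=> nk; apply: H2; rewrite /= (leq_trans _ nk)// leq_maxr.
  rewrite !E; apply: le_lt_trans (ltrD (N2 _ (leqnn n)) (N2 m (leq_maxr _ _))).
  have T0 : 0 <= \prod_i series (fun k => `|a i k|) m - \prod_i series (fun k => `|a i k|) n.
    by rewrite -!E sum_fsetD// sumr_ge0.
  rewrite -[leLHS]ger0_norm//; apply: le_trans (ler_normB _ _).
  by apply: eq_ler; congr `|_|; ring.
have -> : partial_sum x A = \sum_(alpha <- A) x alpha.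
  by rewrite /partial_sum -(big_seq_fsetE _ A xpredT x).
have N1 : `|\prod_i S i - \prod_i series (a i) n| < e / 3.
  by apply: H1; rewrite /= leq_maxl.
rewrite (_ : e = e / 3 + (e / 3 + e / 3)); last by field.
apply: le_lt_trans (ltrD N1 D); apply: le_trans (ler_normB _ _).
by rewrite sum_box_prod /series/=; apply: eq_ler; congr `|_|; ring.
Qed.

End unconditional_product.

(** * Lacunary series and complex limits *)

Section sparse_series.
Variables (R : realType) (n : nat).
Hypothesis n_gt0 : (0 < n)%N.

(** The Taylor coefficients of [sum_p q_p w ^ (n p)]. *)
Definition sparse (q : nat -> R) (k : nat) : R :=
  if (n %| k)%N then q (k %/ n)%N else 0.

Lemma sum_sparse (F : nat -> R) K :
  \sum_(0 <= k < n * K) sparse F k = \sum_(0 <= p < K) F p.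
Proof.
elim: K => [|K IH]; first by rewrite muln0 !big_geq.
have le1 : (n * K <= n * K.+1)%N by rewrite leq_mul2l leqnSn orbT.
rewrite (big_cat_nat (leq0n _) le1)/= IH big_nat_recr//=; congr (_ + _).
have lt1 : (n * K < n * K.+1)%N by rewrite ltn_mul2l n_gt0 ltnSn.
rewrite (big_ltn lt1) {1}/sparse dvdn_mulr// mulKn//.
rewrite big_nat_cond big1 ?addr0// => k /andP[/andP[nKk knK] _].
rewrite /sparse; case: ifP => // /dvdnP[j kE]; move: nKk knK.
by rewrite kE [(j * n)%N]mulnC !ltn_mul2l n_gt0/= ltnS ltnNge => /negbTE ->.
Qed.

Lemma sparseM (q : nat -> R) (x : R) k :
  sparse q k * x ^+ k = sparse (fun p => q p * (x ^+ n) ^+ p) k.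
Proof.
rewrite /sparse; case: ifP => [/dvdnP[j ->]|_]; last by rewrite mul0r.
by rewrite mulnK// -exprM mulnC.
Qed.

Lemma sparse_norm (q : nat -> R) k : `|sparse q k| = sparse (fun p => `|q p|) k.
Proof. by rewrite /sparse; case: ifP; rewrite ?normr0. Qed.

Lemma sparse_cvg (q : nat -> R) :
  (forall t, 0 <= t -> cvgn (pseries q t)) ->
  forall rho, 0 <= rho -> cvgn (series (fun k => `|sparse q k| * rho ^+ k)).
Proof.
move=> qc rho rho0; set t := rho ^+ n; have t0 : 0 <= t by rewrite exprn_ge0.
have A : cvgn (pseries (fun p => `|q p|) t).
  apply: (@is_cvg_pseries_inside_norm _ q (t + 1)); first by apply: qc; rewrite addr_ge0.
  by rewrite !ger0_norm ?addr_ge0// ltrDl.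
have sE k : `|sparse q k| * rho ^+ k = sparse (fun p => `|q p| * t ^+ p) k.
  by rewrite sparse_norm sparseM.
have F0 k : 0 <= `|sparse q k| * rho ^+ k by rewrite mulr_ge0// exprn_ge0.
apply: nondecreasing_is_cvgn.
  by apply/nondecreasing_seqP => k; rewrite seriesSr lerDl.
exists (limn (pseries (fun p => `|q p|) t)) => _ [K _ <-].
apply: (@le_trans _ _ (series (fun k => `|sparse q k| * rho ^+ k) (n * K)%N)).
  by apply: nondecreasing_series => //; rewrite ?leq_pmull// => *; exact: F0.
rewrite /series/=; under eq_bigr do rewrite sE.
rewrite sum_sparse; apply: (nondecreasing_cvgn_le _ A).
apply/nondecreasing_seqP => k; rewrite /pseries seriesSr lerDl.
by rewrite mulr_ge0// exprn_ge0.
Qed.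

Lemma sparse_lim (q : nat -> R) (x l : R) :
  cvgn (pseries (sparse q) x) -> pseries q (x ^+ n) @ \oo --> l ->
  limn (pseries (sparse q) x) = l.
Proof.
move=> c ql; apply: (cvg_unique (@norm_hausdorff _ _)) ql.
have -> : pseries q (x ^+ n) = pseries (sparse q) x \o (fun K => n * K)%N.
  apply/funext => K /=; rewrite /pseries /series/=.
  by rewrite -sum_sparse; apply: eq_bigr => k _; rewrite sparseM.
apply: cvg_comp c; apply: cvg_mulnl => //.
Qed.

End sparse_series.

Section entire_products.
Variables (R : realType).
Let K : numFieldType := R[i].

(** The two components control the modulus. *)
Lemma complex_cvg (s : nat -> R[i]) (a b : R) :
  (fun k => complex.Re (s k)) @ \oo --> a ->
  (fun k => complex.Im (s k)) @ \oo --> b ->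
  (s : nat -> K) @ \oo --> (a +i* b : K).
Proof.
move=> sa sb; apply/cvgrPdist_lt => e e0.
have eE : e = (complex.Re e)%:C.
  by apply/eqP; rewrite eq_complex/= eqxx/=; move: e0; rewrite ltcE => /andP[/eqP->].
have e0' : 0 < complex.Re e / 2.
  by rewrite divr_gt0//; move: e0; rewrite ltcE => /andP[].
have /cvgrPdist_lt/(_ _ e0') Ha := sa.
have /cvgrPdist_lt/(_ _ e0') Hb := sb.
near=> k.
have -> : (a +i* b : R[i]) - s k = (a - complex.Re (s k)) +i* (b - complex.Im (s k)).
  by case: (s k).
rewrite eE normc_def ltcR.
have A : `|a - complex.Re (s k)| < complex.Re e / 2 by near: k.
have B : `|b - complex.Im (s k)| < complex.Re e / 2 by near: k.
rewrite [X in _ < X](splitr (complex.Re e)).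
apply: le_lt_trans (ltrD A B) => /=.
set u := a - _; set v := b - _.
rewrite -(@ler_pXn2r _ 2)// ?nnegrE ?sqrtr_ge0 ?addr_ge0//.
rewrite sqr_sqrtr ?addr_ge0 ?sqr_ge0//.
rewrite -(real_normK (num_real u)) -(real_normK (num_real v)) sqrrD addrAC lerDl.
by rewrite mulrn_wge0// mulr_ge0.
Unshelve. all: by end_near.
Qed.

End entire_products.

(** * Entire functions of several complex variables as products *)

Section entire_products.
Variables (R : realType) (d : nat) (c : nat -> R).
Hypothesis c_cvg : forall rho : R, 0 <= rho ->
  cvgn (series (fun k => `|c k| * rho ^+ k)).
Let K : numFieldType := R[i].

Lemma Re_series (a : nat -> R[i]) k :
  complex.Re (series a k) = series (fun j => complex.Re (a j)) k.
Proof.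
elim: k => [|k IH]; first by rewrite /series/= !big_geq.
by rewrite !seriesSr -IH; case: (series a k) (a k) => ? ? [].
Qed.

Lemma Im_series (a : nat -> R[i]) k :
  complex.Im (series a k) = series (fun j => complex.Im (a j)) k.
Proof.
elim: k => [|k IH]; first by rewrite /series/= !big_geq.
by rewrite !seriesSr -IH; case: (series a k) (a k) => ? ? [].
Qed.

Let term (w : R[i]) k : R[i] := (c k)%:C * w ^+ k.
Let modulus (w : R[i]) : R := complex.Re `|w|.

Lemma modulusE (w : R[i]) : `|w| = (modulus w)%:C.
Proof. by rewrite /modulus normc_def. Qed.

Lemma norm_term w k : `|term w k| = (`|c k| * modulus w ^+ k)%:C.
Proof. by rewrite normrM normc_real normrX modulusE rmorphM rmorphXn. Qed.

Lemma modulus_ge0 w : 0 <= modulus w.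
Proof. by rewrite -lecR -modulusE; exact: normr_ge0. Qed.

(** The limits exist by absolute convergence ([dominated_part]). *)
Definition entire_sum (w : R[i]) : R[i] :=
  limn (series (fun k => complex.Re (term w k))) +i*
  limn (series (fun k => complex.Im (term w k))).

Lemma dominated_part (part : R[i] -> R) w :
  (forall z, `|part z|%:C <= `|z|) ->
  cvgn (series (fun k => part (term w k))).
Proof.
move=> partP; apply: normed_cvg.
apply: (@series_le_cvg _ _ (fun k => `|c k| * modulus w ^+ k)) => [k|k|k|].
- exact: normr_ge0.
- by rewrite mulr_ge0// exprn_ge0// modulus_ge0.
- by rewrite -lecR -norm_term; exact: partP.
- exact: c_cvg (modulus_ge0 w).
Qed.

Lemma entire_sum_cvg w : (series (term w) : nat -> K) @ \oo --> (entire_sum w : K).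
Proof.
apply: complex_cvg.
  under eq_fun do rewrite Re_series.
  exact: dominated_part (@normc_ge_Re R).
under eq_fun do rewrite Im_series.
apply: dominated_part => z.
rewrite normc_def lecR -sqrtr_sqr ler_wsqrtr// lerDr sqr_ge0//.
Qed.

Lemma entire_sum_real (x : R) : entire_sum x%:C = (limn (pseries c x))%:C.
Proof.
have E k : term x%:C k = (c k * x ^+ k)%:C by rewrite rmorphM rmorphXn.
rewrite /entire_sum; congr (limn _ +i* _).
  by apply/funext => k; apply: eq_bigr => j _; rewrite E.
have -> : series (fun k => complex.Im (term x%:C k)) = cst 0.
  by apply/funext => k; rewrite /series/= big1// => j _; rewrite E.
exact: lim_cst.
Qed.

Lemma entire_product_sum :
  power_series_sum (fun alpha => \prod_i (c (alpha i))%:C)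
    (fun z : 'rV[R[i]]_d => \prod_i entire_sum (z 0 i)).
Proof.
move=> z.
have -> : (fun alpha : {ffun 'I_d -> nat} => (\prod_i (c (alpha i))%:C) * monomial alpha z) =
    (fun alpha => \prod_i term (z 0 i) (alpha i)).
  by apply/funext => alpha; rewrite /monomial -big_split.
apply: (@unconditional_product K d (fun i k => term (z 0 i) k) (fun i => entire_sum (z 0 i))
  (fun i => (limn (series (fun k => `|c k| * modulus (z 0 i) ^+ k)))%:C)) => i.
  exact: entire_sum_cvg.
have E k : series (fun k => `|term (z 0 i) k|) k =
    (series (fun k => `|c k| * modulus (z 0 i) ^+ k) k)%:C.
  by rewrite /series/= rmorph_sum; apply: eq_bigr => j _; rewrite norm_term.
apply: complex_cvg.
  by under eq_fun do rewrite E/=; exact: c_cvg (modulus_ge0 _).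
by under eq_fun do rewrite E/=; exact: cvg_cst.
Qed.

End entire_products.

(** * The weighted bound in several variables *)

Section weights.
Variables (R : realType) (d : nat).
Hypothesis d_gt0 : (0 < d)%N.

(** The associated function is a supremum of logarithms; each of them is at
    most [ln (T / V)] under the stated inequalities. *)
Lemma le_expR_associated (B : nat -> R) (rho V T : R) :
  (forall p, 0 < B p) -> 0 <= rho -> 0 <= V -> V <= T ->
  (forall p, V * rho ^+ p <= T * B p) ->
  V <= T * expR (- associated_function B rho).
Proof.
move=> B0 rho0 V0 VT H.
have T0 : 0 <= T by exact: le_trans VT.
move: V0; rewrite le_eqVlt => /predU1P[<-|V0]; first by rewrite mulr_ge0// expR_ge0.
have T1 : 0 < T by exact: lt_le_trans VT.
have TV : 0 < T / V by rewrite divr_gt0.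
have A : associated_function B rho <= ln (T / V).
  apply: ge_sup; first by exists (log_plus (rho ^+ 0 / B 0%N)); exists 0%N.
  move=> _ [p _ <-]; rewrite /log_plus ge_max.
  rewrite ln_ge0 ?ler_pdivlMr ?mul1r//=.
  have [r0|r0] := leP (rho ^+ p / B p) 0.
    by rewrite ln0// ln_ge0// ler_pdivlMr// mul1r.
  rewrite ler_ln// ?posrE// ler_pdivrMr// mulrAC ler_pdivlMr// mulrC.
  exact: H.
have : expR (- ln (T / V)) <= expR (- associated_function B rho) by rewrite ler_expR lerN2.
rewrite expRN lnK ?posrE// invf_div => /(ler_wpM2l T0).
by apply: le_trans; rewrite mulrCA divff ?mulr1// gt_eqF.
Qed.

Lemma exists_max_coordinate (x : 'rV[R]_d) :
  exists i, euclidean_norm x <= d%:R * `|x 0 i|.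
Proof.
case: d d_gt0 x => // d' _ x.
have [i _ Hi] := @arg_maxP _ _ _ ord0 xpredT (fun i => `|x 0 i|) isT.
exists i; rewrite /euclidean_norm.
rewrite -(@ler_pXn2r _ 2)// ?nnegrE ?sqrtr_ge0 ?mulr_ge0//.
rewrite sqr_sqrtr ?sumr_ge0// => [|j _]; last exact: sqr_ge0.
apply: (@le_trans _ _ (\sum_(j < d'.+1) `|x 0 i| ^+ 2)).
  by apply: ler_sum => j _; rewrite -real_normK ?num_real// lerXn2r ?nnegrE//; exact: Hi.
rewrite sumr_const card_ord -[leLHS]mulr_natl exprMn ler_wpM2r ?sqr_ge0//.
by rewrite -natrX ler_nat leq_pmull.
Qed.

(** All factors obey the bound without weight; the factor at the coordinate of
    largest modulus is bounded with the weight, evaluated at [d] times that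
    modulus, which is at least the Euclidean norm. *)
Lemma prod_derivatives_le (g : nat -> R -> R) (B : nat -> R) (C r kappa : R)
  (x : 'rV[R]_d) (alpha : {ffun 'I_d -> nat}) :
  (forall p, 0 < B p) -> 0 < C -> 0 < r -> 0 < kappa ->
  (forall m t, `|g m t| <= C * (m`!%:R / r ^+ m) /\
     forall p, `|g m t| * (kappa * d%:R * `|t|) ^+ p <= C * (m`!%:R / r ^+ m) * B p) ->
  `|\prod_i g (alpha i) (x 0 i)| <=
    C ^+ d * ((mfact alpha)%:R / r ^+ mdeg alpha) *
      expR (- associated_function B (kappa * euclidean_norm x)).
Proof.
move=> B0 C0 r0 kappa0 Hg.
pose w m : R := C * (m`!%:R / r ^+ m).
have w0 m : 0 <= w m by rewrite mulr_ge0 ?(ltW C0)// divr_ge0// exprn_ge0// ltW.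
have prod_w : \prod_i w (alpha i) = C ^+ d * ((mfact alpha)%:R / r ^+ mdeg alpha).
  rewrite big_split/= prodr_const card_ord; congr (_ * _).
  rewrite big_split/= prodfV /mfact /mdeg natr_prod; congr (_ / _).
  by rewrite expr_sum.
have k0 : 0 <= kappa * euclidean_norm x by rewrite mulr_ge0 ?sqrtr_ge0// ltW.
rewrite -prod_w normr_prod; apply: le_expR_associated => // [||p].
- by rewrite prodr_ge0.
- by apply: ler_prod => i _; rewrite normr_ge0; case: (Hg (alpha i) (x 0 i)).
have [i Hi] := exists_max_coordinate x.
apply: (@le_trans _ _ (\prod_i `|g (alpha i) (x 0 i)| * (kappa * d%:R * `|x 0 i|) ^+ p)).
  have E : kappa * euclidean_norm x <= kappa * d%:R * `|x 0 i|.
    by rewrite -mulrA ler_pM2l.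
  by rewrite ler_wpM2l ?prodr_ge0// lerXn2r ?nnegrE// (le_trans k0 E).
rewrite (bigD1 i)//= [X in _ <= X * _](bigD1 i)//= mulrAC [leRHS]mulrAC.
apply: ler_pM.
- by rewrite mulr_ge0// exprn_ge0// !mulr_ge0// ltW.
- by rewrite prodr_ge0.
- by case: (Hg (alpha i) (x 0 i)) => _.
- by apply: ler_prod => j _; rewrite normr_ge0; case: (Hg (alpha j) (x 0 j)).
Qed.

End weights.

(** Both cases of the theorem are instances of this construction, which differ
    only in the weight [B] and in how the bound on the coefficients [q] is
    exploited. *)
Theorem product_ultrapolynomial (R : realType) (d : nat) (B : nat -> R)
    (c kappa r : R) (N : nat) : (0 < d)%N ->
  (forall p, 0 < B p) -> B 0%N = 1 ->
  (forall i j, (i <= j)%N -> B j / B j.+1 <= B i / B i.+1) ->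
  (0 < N)%N -> 0 <= c ->
  (forall p n, (0 < p)%N ->
    \sum_(p <= j < n) (B j / B j.+1) ^+ N.*2 <= c * p%:R * (B p / B p.+1) ^+ N.*2) ->
  0 < kappa -> 0 < r ->
  exists (q : nat -> R) (P : 'rV[R[i]]_d -> R[i]),
    [/\ exists2 L : R, 0 < L & forall p, `|q p| <= L ^+ p / B p ^+ N.*2,
        power_series_sum (fun alpha : {ffun 'I_d -> nat} =>
          \prod_i (sparse N.*2 q (alpha i))%:C) P,
        forall x : 'rV[R]_d, P (complexify x) != 0
      & exists2 C : R, 0 < C & forall (x : 'rV[R]_d) (alpha : {ffun 'I_d -> nat}),
          `|D alpha (fun y => 1 / P (complexify y)) x|
            <= (C * ((mfact alpha)%:R / r ^+ mdeg alpha)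
                  * expR (- associated_function B (kappa * euclidean_norm x)))%:C].
Proof.
move=> d0 B_gt0 B0 nuB N0 c0 tailB kappa0 r0.
have kd0 : 0 < kappa * d%:R by rewrite mulr_gt0// ltr0n.
have [q [h [L [C [L0 C0 qL hP [hD hB]]]]]] :=
  one_variable_product B_gt0 B0 nuB N0 c0 tailB kd0 r0.
have n0 : (0 < N.*2)%N by rewrite double_gt0.
have qcvg t : 0 <= t -> cvgn (pseries q t).
  move=> t0; have [_ /cvgP c1] := hP (t + 1).
  apply: (is_cvg_pseries_inside c1).
  have t1 : 1 <= t + 1 by rewrite lerDr.
  rewrite !ger0_norm ?exprn_ge0 ?addr_ge0//.
  by apply: lt_le_trans (ler_eXnr n0 t1); rewrite ltrDl.
have cvg_sp := sparse_cvg n0 qcvg.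
pose P (z : 'rV[R[i]]_d) : R[i] := \prod_i entire_sum (sparse N.*2 q) (z 0 i).
have PE (x : 'rV[R]_d) : P (complexify x) = (\prod_i (h (x 0 i))^-1)%:C.
  rewrite rmorph_prod; apply: eq_bigr => i _.
  rewrite /complexify mxE entire_sum_real; congr (_ %:C).
  have [_ hl] := hP (x 0 i).
  apply: (sparse_lim n0 _ hl); apply: normed_cvg.
  have := cvg_sp `|x 0 i| (normr_ge0 _).
  by under eq_fun do rewrite -normrX -normrM.
have h_gt0 t : 0 < h t by case: (hP t).
exists q, P; split.
- by exists L.
- exact: entire_product_sum.
- move=> x; rewrite PE eq_complex/= negb_and gt_eqF//.
  by rewrite prodr_gt0// => i _; rewrite invr_gt0.
exists (C ^+ d); first by rewrite exprn_gt0.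
move=> x alpha.
have fE : (fun y => 1 / P (complexify y)) =
    fun y : 'rV[R]_d => (\prod_i derive1n 0 h (y 0 i))%:C.
  apply/funext => y; rewrite PE div1r -fmorphV; congr (_ %:C).
  by rewrite prodfV invrK.
have M := @mpartial_prod R d (fun m => derive1n m h) (fun m t => hD m t) alpha.
rewrite fE (norm_D_real (congr1 (fun f => f x) M)).
rewrite lecR.
exact: (@prod_derivatives_le R d d0 (fun m => derive1n m h) B C r kappa x alpha
  B_gt0 C0 r0 kappa0 hB).
Qed.

(** * Weight sequences and ultrapolynomial coefficients *)

Section weight_sequence.
Variables (R : realType) (M : nat -> R).
Hypothesis M_gt0 : forall p, 0 < M p.
Hypothesis M0 : M 0%N = 1.

Lemma ratio_noninc : log_convex M ->
  forall i j, (i <= j)%N -> M j / M j.+1 <= M i / M i.+1.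
Proof.
move=> lc i j; elim: j => [|j IH]; first by rewrite leqn0 => /eqP->.
rewrite leq_eqVlt => /predU1P[->//|]; rewrite ltnS => /IH; apply: le_trans.
rewrite ler_pdivrMr// mulrAC ler_pdivlMr//.
by have := lc j.+1 isT; rewrite expr2.
Qed.

Lemma sum_powR_le (q c0 : R) p n : (0 < p)%N ->
  (forall p, (0 < p)%N ->
    (\sum_(p.+1 <= j <oo) ((M j.-1 `^ q) / (M j `^ q))%:E
       <= (c0 * p%:R * (M p `^ q / M p.+1 `^ q))%:E)%E) ->
  \sum_(p <= j < n) (M j / M j.+1) `^ q <= c0 * p%:R * (M p / M p.+1) `^ q.
Proof.
move=> p0 H.
have powR_div i j : (M i / M j) `^ q = M i `^ q / M j `^ q.
  rewrite powRM ?(ltW (M_gt0 _)) ?invr_ge0 ?(ltW (M_gt0 _))//.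
  by rewrite -powR_inv1 ?(ltW (M_gt0 _))// -powRrM mulN1r powRN.
rewrite -lee_fin powR_div; apply: le_trans (H p p0).
have u0 j : (p.+1 <= j)%N -> xpredT j -> (0 <= (M j.-1 `^ q / M j `^ q)%:E)%E.
  by move=> _ _; rewrite lee_fin divr_ge0// powR_ge0.
apply: le_trans (nneseries_lim_ge n.+1 u0).
rewrite big_add1/= sumEFin lee_fin; apply: eq_ler.
by apply: eq_bigr => j _; rewrite powR_div.
Qed.

(** Strong non-quasianalyticity of a power is inherited by all higher powers:
    the ratios decrease, so the surplus exponent can be frozen at the first
    index of the tail. *)
Lemma sum_ratio_le : log_convex M -> power_strongly_nonquasianalytic M ->
  exists c N, [/\ (0 < N)%N, 0 <= c & forall p n, (0 < p)%N ->
    \sum_(p <= j < n) (M j / M j.+1) ^+ N.*2 <= c * p%:R * (M p / M p.+1) ^+ N.*2].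
Proof.
move=> lc [q q0 [c0 c01 H]].
pose N := (Num.truncn q).+1.
have qN : q <= N.*2%:R.
  by apply: ltW; apply: lt_le_trans (truncnS_gt q) _; rewrite ler_nat -addnn leq_addr.
exists c0, N; split=> // [|p n p0]; first exact: le_trans c01.
have nu0 j : 0 < M j / M j.+1 by rewrite divr_gt0.
have E j : (M j / M j.+1) ^+ N.*2 = (M j / M j.+1) `^ q * (M j / M j.+1) `^ (N.*2%:R - q).
  rewrite -powRD; last by apply/implyP => _; rewrite gt_eqF.
  by rewrite addrC subrK powR_mulrn// ltW.
rewrite [in leRHS]E mulrA.
apply: (@le_trans _ _
  (\sum_(p <= j < n) (M j / M j.+1) `^ q * (M p / M p.+1) `^ (N.*2%:R - q))).
  rewrite big_nat_cond [leRHS]big_nat_cond; apply: ler_sum => j /andP[/andP[pj _] _].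
  rewrite E ler_wpM2l ?powR_ge0//.
  by apply: ge0_ler_powR; rewrite ?subr_ge0 ?nnegrE ?(ltW (nu0 _))//; exact: ratio_noninc.
by rewrite -mulr_suml ler_wpM2r ?powR_ge0//; exact: sum_powR_le.
Qed.

Section stable.
Variables c0 H : R.
Hypotheses (c01 : 1 <= c0) (H1 : 1 <= H).
Hypothesis M_stable : forall p,
  M p <= c0 * H ^+ p * \big[Num.min/M p * M 0%N]_(q < p.+1) (M (p - q)%N * M q).

Let c00 : 0 <= c0. Proof. exact: le_trans c01. Qed.
Let H0 : 0 <= H. Proof. exact: le_trans H1. Qed.

Lemma stable_add p q : M (p + q) <= c0 * H ^+ (p + q) * (M p * M q).
Proof.
apply: le_trans (M_stable (p + q)) _; rewrite ler_wpM2l ?mulr_ge0 ?exprn_ge0//.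
have qpq : (q < (p + q).+1)%N by rewrite ltnS leq_addl.
have := bigmin_le (M (p + q) * M 0%N) (Ordinal qpq) (fun i : 'I__ => M (p + q - i)%N * M i).
by rewrite /= addnK.
Qed.

(** (M.2) iterated over the terms of a finite sum of indices. *)
Lemma stable_sum (I : Type) (s : seq I) (e : I -> nat) :
  M (\sum_(i <- s) e i) <=
    c0 ^+ size s * (H ^+ size s) ^+ (\sum_(i <- s) e i) * \prod_(i <- s) M (e i).
Proof.
elim: s => [|i s IH] /=; first by rewrite !big_nil M0 !expr0 !mulr1.
rewrite !big_cons; set S := (\sum_(j <- s) e j)%N in IH *.
set Pi := \prod_(j <- s) M (e j) in IH *.
have Pi0 : 0 <= Pi by rewrite prodr_ge0// => j _; exact: ltW.
have A : 0 <= c0 * H ^+ (e i + S) * M (e i).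
  by rewrite !mulr_ge0 ?exprn_ge0// ltW.
apply: le_trans (stable_add _ _) _; rewrite mulrA.
apply: le_trans (ler_wpM2l A IH) _.
have E : (H ^+ size s) ^+ S <= (H ^+ size s) ^+ (e i + S).
  by rewrite ler_weXn2l ?leq_addl// exprn_ege1.
rewrite [leRHS](_ : _ = c0 * H ^+ (e i + S) * M (e i) *
    (c0 ^+ size s * (H ^+ size s) ^+ (e i + S) * Pi)).
  by rewrite ler_wpM2l// ler_wpM2r// ler_wpM2l ?exprn_ge0.
rewrite (exprS c0) [(H ^+ (size s).+1) ^+ _](_ : _ = H ^+ (e i + S) * (H ^+ size s) ^+ (e i + S)).
  by move: (H ^+ (e i + S)) ((H ^+ size s) ^+ _) (c0 ^+ size s) => *; ring.
by rewrite -exprMn -exprS.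
Qed.

Lemma stable_muln n p : M (n * p) <= c0 ^+ n * (H ^+ n) ^+ (n * p) * M p ^+ n.
Proof.
have := stable_sum (nseq n tt) (fun=> p).
by rewrite size_nseq !big_nseq iter_addn_0 iter_mulr_1 mulnC.
Qed.

(** The coefficient of [w ^ (n p)] is compared with [M (n p)] through
    [M (n p) <= c0^n H^(n n p) M_p^n]. *)
Lemma sparse_class (q : nat -> R) n (T lambda : R) : (0 < n)%N -> 0 < T -> 0 < lambda ->
  (forall p, `|q p| <= T * lambda ^+ (n * p) / M p ^+ n) ->
  forall k, `|sparse n q k| <= T * c0 ^+ n * (lambda * H ^+ n) ^+ k / M k.
Proof.
move=> n0 T0 l0 qT k; rewrite /sparse; case: ifP => [/dvdnP[p ->]|_]; last first.
  rewrite normr0 divr_ge0 ?(ltW (M_gt0 _))//.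
  by rewrite !mulr_ge0 ?exprn_ge0 ?mulr_ge0 ?exprn_ge0 ?(ltW l0) ?(ltW T0).
rewrite mulnK// [(p * n)%N]mulnC; apply: le_trans (qT p) _.
rewrite ler_pdivrMr ?exprn_gt0// mulrAC ler_pdivlMr//.
rewrite [leRHS](_ : _ = T * lambda ^+ (n * p) * (c0 ^+ n * (H ^+ n) ^+ (n * p) * M p ^+ n)).
  by rewrite ler_wpM2l ?stable_muln// mulr_ge0 ?exprn_ge0// ltW.
rewrite exprMn.
by move: (lambda ^+ _) ((H ^+ n) ^+ _) (c0 ^+ n) (M p ^+ n) => *; ring.
Qed.

Lemma product_class d (a : nat -> R) (C L : R) : 0 <= C -> 0 <= L ->
  (forall k, `|a k| <= C * L ^+ k / M k) ->
  forall alpha : {ffun 'I_d -> nat},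
    `|\prod_i (a (alpha i))%:C| <=
      ((C ^+ d * c0 ^+ d) * (L * H ^+ d) ^+ mdeg alpha / M (mdeg alpha))%:C :> R[i].
Proof.
move=> C0 L0 aC alpha.
have -> : \prod_i (a (alpha i))%:C = (\prod_i a (alpha i))%:C by rewrite rmorph_prod.
rewrite normc_real lecR normr_prod.
apply: (@le_trans _ _ (\prod_i (C * L ^+ alpha i / M (alpha i)))).
  by apply: ler_prod => i _; rewrite normr_ge0 aC.
rewrite big_split/= big_split/= prodr_const card_ord prodfV -expr_sum -/(mdeg alpha).
have P0 : 0 < \prod_i M (alpha i) by rewrite prodr_gt0.
rewrite ler_pdivrMr// mulrAC ler_pdivlMr//.
have := stable_sum (index_enum 'I_d) alpha; rewrite -/(mdeg alpha).
have -> : size (index_enum 'I_d) = d by rewrite /index_enum -enumT size_enum_ord.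
move=> /(ler_wpM2l (_ : 0 <= C ^+ d * L ^+ mdeg alpha)).
rewrite mulr_ge0 ?exprn_ge0// => /(_ isT) /le_trans; apply.
rewrite exprMn; apply: eq_ler.
by move: (C ^+ d) (c0 ^+ d) (L ^+ _) ((H ^+ d) ^+ _) (\prod_i _) => *; ring.
Qed.

End stable.

(** The factors exceed [A] from some index on, so the quotient
    [A ^ p / prod k] is largest among the first finitely many [p]. *)
Lemma prod_growth (k : nat -> R) (A : R) : increasing_to_infinity k -> 0 < A ->
  exists2 T, 0 < T & forall p, A ^+ p <= T * \prod_(1 <= j < p.+1) k j.
Proof.
move=> [k0 _ koo] A0.
have [J HJ] : exists J, forall j, (J <= j)%N -> A <= k j.
  have /cvgryPge/(_ A)[J _ HJ] := koo.
  by exists J => j Jj; exact: HJ.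
have [T1 T10 HT1] : exists2 T1, 0 < T1 & forall p, (p <= J)%N ->
    A ^+ p <= T1 * \prod_(1 <= j < p.+1) k j.
  have P0 p : 0 < \prod_(1 <= j < p.+1) k j.
    by rewrite big_nat_cond prodr_gt0// => j /andP[/andP[j1 _] _]; exact: k0.
  have F0 p : 0 < A ^+ p / \prod_(1 <= j < p.+1) k j by rewrite divr_gt0// exprn_gt0.
  exists (\sum_(p < J.+1) A ^+ p / \prod_(1 <= j < p.+1) k j).
    by rewrite big_ord_recl ltr_wpDr// sumr_ge0// => i _; exact: ltW.
  move=> p pJ; rewrite -ler_pdivrMr// -ltnS in pJ *.
  by rewrite (bigD1 (Ordinal pJ))//= lerDl sumr_ge0// => i _; exact: ltW.
exists T1 => // p; have [|/ltnW Jp] := leqP p J; first exact: HT1.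
rewrite -(subnKC Jp); elim: (p - J)%N => [|m IH]; first by rewrite addn0 HT1.
rewrite addnS exprSr big_nat_recr//= mulrA ler_pM ?exprn_ge0 ?(ltW A0)//.
by apply: HJ; rewrite -addnS leq_addr.
Qed.

End weight_sequence.

(** * The two classes of ultrapolynomials *)

Lemma mul_prod_ratio (R : realType) (M k : nat -> R) j :
  (forall p, (0 < p)%N -> 0 < k p) ->
  mul_prod M k j / mul_prod M k j.+1 = M j / M j.+1 / k j.+1.
Proof.
move=> k0; rewrite /mul_prod (big_nat_recr j.+1)//=.
have : \prod_(1 <= i < j.+1) k i != 0.
  by rewrite gt_eqF// big_nat_cond prodr_gt0// => i /andP[/andP[i1 _] _]; exact: k0.
move: (\prod_(_ <= i < _) _) => P P0.
by rewrite !invfM mulrACA; congr (_ * _); rewrite mulrA divff// mul1r.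
Qed.

Section ultrapolynomial_classes.
Variables (R : realType) (M : nat -> R).
Hypothesis M_gt0 : forall p, 0 < M p.
Variables (d n : nat) (c0 H : R).
Hypothesis M0 : M 0%N = 1.
Hypotheses (c01 : 1 <= c0) (H1 : 1 <= H) (n_gt0 : (0 < n)%N).
Hypothesis M_stable : forall p,
  M p <= c0 * H ^+ p * \big[Num.min/M p * M 0%N]_(q < p.+1) (M (p - q)%N * M q).
Variables (q : nat -> R) (L : R).
Hypothesis L_gt0 : 0 < L.

Let le_max_pow p : L ^+ p <= Num.max 1 L ^+ (n * p).
Proof.
have m1 : 1 <= Num.max 1 L by rewrite le_max lexx.
apply: (@le_trans _ _ (Num.max 1 L ^+ p)).
  by rewrite lerXn2r ?nnegrE ?(ltW L_gt0) ?(le_trans ler01 m1)// le_max lexx orbT.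
by rewrite ler_weXn2l// leq_pmull.
Qed.

Lemma Beurling_class : (forall p, `|q p| <= L ^+ p / M p ^+ n) ->
  exists L' C : R, [/\ 0 < L', 0 < C & forall alpha : {ffun 'I_d -> nat},
     `|\prod_i (sparse n q (alpha i))%:C| <=
       (C * L' ^+ mdeg alpha / M (mdeg alpha))%:C :> R[i]].
Proof.
move=> qL; pose l := Num.max 1 L.
have l0 : 0 < l by rewrite lt_max ltr01.
have c00 : 0 < c0 by exact: lt_le_trans c01.
have H0 : 0 < H by exact: lt_le_trans H1.
have S := @sparse_class R M M_gt0 M0 c0 H c01 H1 M_stable q n 1 l n_gt0 ltr01 l0.
exists (l * H ^+ n * H ^+ d), ((1 * c0 ^+ n) ^+ d * c0 ^+ d).
split; rewrite ?mulr_gt0 ?exprn_gt0 ?mulr_gt0 ?exprn_gt0//.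
apply: (product_class M_gt0 M0 c01 H1 M_stable).
- by rewrite mul1r exprn_ge0// ltW.
- by rewrite mulr_ge0 ?exprn_ge0// ltW.
apply: S => p; apply: le_trans (qL p) _.
by rewrite mul1r ler_pM2r ?invr_gt0 ?exprn_gt0//; exact: le_max_pow.
Qed.

Lemma Roumieu_class (k : nat -> R) : increasing_to_infinity k ->
  (forall p, `|q p| <= L ^+ p / mul_prod M k p ^+ n) ->
  forall L' : R, 0 < L' -> exists2 C : R, 0 < C & forall alpha : {ffun 'I_d -> nat},
     `|\prod_i (sparse n q (alpha i))%:C| <=
       (C * L' ^+ mdeg alpha / M (mdeg alpha))%:C :> R[i].
Proof.
move=> kinf qL L' L'0; pose l1 := Num.max 1 L.
have l10 : 0 < l1 by rewrite lt_max ltr01.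
have c00 : 0 < c0 by exact: lt_le_trans c01.
have H0 : 0 < H by exact: lt_le_trans H1.
pose l := L' / (H ^+ n * H ^+ d).
have l0 : 0 < l by rewrite divr_gt0 ?mulr_gt0 ?exprn_gt0.
have [T T0 HT] := prod_growth kinf (divr_gt0 l10 l0).
have Tn0 : 0 < T ^+ n by rewrite exprn_gt0.
have S := @sparse_class R M M_gt0 M0 c0 H c01 H1 M_stable q n (T ^+ n) l n_gt0 Tn0 l0.
exists ((T ^+ n * c0 ^+ n) ^+ d * c0 ^+ d).
  by rewrite !mulr_gt0 ?exprn_gt0 ?mulr_gt0 ?exprn_gt0.
have -> : L' = l * H ^+ n * H ^+ d by rewrite -mulrA /l divfK// gt_eqF// mulr_gt0 ?exprn_gt0.
apply: (product_class M_gt0 M0 c01 H1 M_stable).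
- by rewrite mulr_ge0 ?exprn_ge0// ltW.
- by rewrite mulr_ge0 ?exprn_ge0// ltW.
have [k0 _ _] := kinf.
have P0 p : 0 < \prod_(1 <= j < p.+1) k j.
  by rewrite big_nat_cond prodr_gt0// => j /andP[/andP[j1 _] _]; exact: k0.
apply: S => p; apply: le_trans (qL p) _.
rewrite /mul_prod exprMn invfM mulrA ler_pdivrMr ?exprn_gt0//.
rewrite mulrAC ler_pM2r ?invr_gt0 ?exprn_gt0//.
apply: le_trans (le_max_pow p) _; rewrite -/l1.
have -> : l1 ^+ (n * p) = ((l1 / l) ^+ p) ^+ n * l ^+ (n * p).
  by rewrite -exprM mulnC -exprMn divfK// gt_eqF.
rewrite mulrAC ler_pM2r ?exprn_gt0// -exprMn.
apply: lerXn2r (HT p); rewrite nnegrE.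
  by rewrite exprn_ge0// divr_ge0 ?(ltW l10) ?(ltW l0).
by rewrite mulr_ge0 ?(ltW T0) ?(ltW (P0 p)).
Qed.

End ultrapolynomial_classes.

(** The Beurling case uses the weight [M] itself and the given dilation.  In the
    Roumieu case the weight is [mul_prod M k]; its ratios are those of [M]
    divided by the terms of [k], so monotonicity of [k] preserves both the
    monotonicity of the ratios and their tail condition. *)
Theorem lemma2p1 (R : realType) (d : nat) (M : nat -> R) (r : R)
    (d_gt0 : (0 < d)%N)
    (M_gt0 : forall p, 0 < M p) (M0 : M 0%N = 1) (M1 : M 1%N = 1)
    (M_1 : log_convex M) (M_2 : stable_ultradiff M)
    (M_5 : power_strongly_nonquasianalytic M)
    (r_ge1 : 1 <= r) :
  (forall k : R, 0 < k ->
     exists P : 'rV[R[i]]_d -> R[i],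
       [/\ ultrapolynomial_Beurling M P,
           forall x : 'rV[R]_d, P (complexify x) != 0
         & exists2 C : R, 0 < C &
             forall (x : 'rV[R]_d) (alpha : {ffun 'I_d -> nat}),
               `|D alpha (fun y => 1 / P (complexify y)) x|
               <= (C * ((mfact alpha)%:R / r ^+ mdeg alpha)
                     * expR (- associated_function M
                                 (k * euclidean_norm x)))%:C])
  /\
  (forall k : nat -> R, increasing_to_infinity k ->
     exists P : 'rV[R[i]]_d -> R[i],
       [/\ ultrapolynomial_Roumieu M P,
           forall x : 'rV[R]_d, P (complexify x) != 0
         & exists2 C : R, 0 < C &
             forall (x : 'rV[R]_d) (alpha : {ffun 'I_d -> nat}),
               `|D alpha (fun y => 1 / P (complexify y)) x|
               <= (C * ((mfact alpha)%:R / r ^+ mdeg alpha)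
                     * expR (- associated_function (mul_prod M k)
                                 (euclidean_norm x)))%:C]).
Proof.
have r0 : 0 < r by exact: lt_le_trans r_ge1.
have [c [N [N0 c_ge0 tail]]] := sum_ratio_le M_gt0 M_1 M_5.
have [c0 [H [c01 H1 M_stable]]] := M_2.
have n0 : (0 < N.*2)%N by rewrite double_gt0.
have nu_noninc := ratio_noninc M_gt0 M_1.
split=> k.
  move=> k_gt0.
  have [q [P [[L L0 qL] Psum Pn0 PC]]] :=
    product_ultrapolynomial d_gt0 M_gt0 M0 nu_noninc N0 c_ge0 tail k_gt0 r0.
  exists P; split=> //; exists (fun alpha => \prod_i (sparse N.*2 q (alpha i))%:C) => //.
  exact: (Beurling_class M_gt0 d M0 c01 H1 n0 M_stable L0 qL).
move=> kinf; have [k0 kinc _] := kinf.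
have k_le i j : (i <= j)%N -> k i.+1 <= k j.+1.
  elim: j => [|j IH]; first by rewrite leqn0 => /eqP->.
  rewrite leq_eqVlt => /predU1P[->//|]; rewrite ltnS => /IH/le_trans; apply.
  exact: kinc.
have B_gt0 p : 0 < mul_prod M k p.
  by rewrite mulr_gt0// big_nat_cond prodr_gt0// => j /andP[/andP[j1 _] _]; exact: k0.
have B0 : mul_prod M k 0 = 1 by rewrite /mul_prod big_geq// M0 mulr1.
have nu0 j : 0 < M j / M j.+1 by rewrite divr_gt0.
have B_noninc i j : (i <= j)%N ->
    mul_prod M k j / mul_prod M k j.+1 <= mul_prod M k i / mul_prod M k i.+1.
  move=> ij; rewrite !mul_prod_ratio// ler_pM ?invr_ge0 ?(ltW (nu0 _)) ?(ltW (k0 _ _))//.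
    exact: nu_noninc.
  by rewrite lef_pV2 ?posrE ?k0// k_le.
have B_tail p n : (0 < p)%N ->
    \sum_(p <= j < n) (mul_prod M k j / mul_prod M k j.+1) ^+ N.*2 <=
      c * p%:R * (mul_prod M k p / mul_prod M k p.+1) ^+ N.*2.
  move=> p0; rewrite mul_prod_ratio// exprMn mulrA.
  have kp0 : 0 <= (k p.+1)^-1 ^+ N.*2 by rewrite exprn_ge0// invr_ge0 ltW// k0.
  apply: le_trans (ler_wpM2r kp0 (tail p n p0)); rewrite mulr_suml.
  rewrite big_nat_cond [leRHS]big_nat_cond; apply: ler_sum => j /andP[/andP[pj _] _].
  rewrite mul_prod_ratio// exprMn ler_wpM2l ?exprn_ge0 ?(ltW (nu0 _))//.
  by rewrite lerXn2r ?nnegrE ?invr_ge0 ?(ltW (k0 _ _))// lef_pV2 ?posrE ?k0// k_le.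
have [q [P [[L L0 qL] Psum Pn0 [C C0 PC]]]] :=
  product_ultrapolynomial d_gt0 B_gt0 B0 B_noninc N0 c_ge0 B_tail ltr01 r0.
exists P; split=> //; last first.
  exists C; first exact: C0.
  by move=> x alpha; rewrite -[euclidean_norm x]mul1r; exact: PC.
exists (fun alpha => \prod_i (sparse N.*2 q (alpha i))%:C) => //.
exact: (Roumieu_class M_gt0 d M0 c01 H1 n0 M_stable L0 kinf qL).
Qed.
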